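(* Let $K$ be a number field and $Y\subset\mathbb{P}^R$ a projective subvariety defined over $K$ of dimension $n\ge1$ and degree $\Delta_Y$. Let $m\ge n$ be an integer and $\mathbf{c}=(c_0,\ldots,c_R)$ a tuple of non-negative reals. Let $H_i=\{y_i=0\}$ $(0\le i\le R)$ be the coordinate hyperplanes of $\mathbb{P}^R$. Let $\{i_0,\ldots,i_m\}$ be a subset of $\{0,\ldots,R\}$ such that $Y(\overline{K})\cap\bigcap_{j=0}^mH_{i_j}=\emptyset$ and $Y\not\subset H_{i_j}$ for all $j=0,\ldots,m$. Assume that the distributive constant of the family $\{H_{i_j}\}_{j=0}^m$ with respect to $Y$ is at most $\delta$. Then $$e_Y(\mathbf{c})\ge\frac{\Delta_Y(n+\delta)}{(m+1)\delta}\,(c_{i_0}+\cdots+c_{i_m}).$$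
   Context: The Chow form $F_Y$ of $Y$ is the (up to scalar) unique polynomial in $n+1$ blocks of variables $\mathbf{u}_i=(u_{i0},\ldots,u_{iR})$ which is irreducible over $K$, homogeneous of degree $\Delta_Y$ in each block, and satisfies $F_Y(\mathbf{u}_0,\ldots,\mathbf{u}_n)=0$ iff $Y\cap H_{\mathbf{u}_0}\cap\cdots\cap H_{\mathbf{u}_n}$ contains a $\overline{K}$-point, where $H_{\mathbf{u}_i}=\{u_{i0}y_0+\cdots+u_{iR}y_R=0\}$. The Chow weight $e_Y(\mathbf{c})$: with an auxiliary variable $t$, write $F_Y(t^{c_0}u_{00},\ldots,t^{c_R}u_{0R};\ldots;t^{c_0}u_{n0},\ldots,t^{c_R}u_{nR})=t^{e_0}G_0+\cdots+t^{e_r}G_r$ with nonzero polynomials $G_i$ in the $u$'s and $e_0>e_1>\cdots>e_r$; then $e_Y(\mathbf{c}):=e_0$. Distributive constant: for hypersurfaces $D_1,\ldots,D_q$ with $Y\not\subset D_j$, it is $\max_{\emptyset\ne J\subset\{1,\ldots,q\}}\frac{\#J}{\dim Y-\dim\big(Y\cap\bigcap_{j\in J}D_j\big)}$, with $\dim\emptyset=-\infty$. *)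

(* Defs.v *)
From HB Require Import structures.
From mathcomp Require Import all_boot all_order all_algebra all_field.
From mathcomp Require Import mpoly.
From mathcomp Require Import boolp classical_sets reals constructive_ereal ereal.

Set Implicit Arguments.
Unset Strict Implicit.
Unset Printing Implicit Defensive.

Import Order.TTheory GRing.Theory Num.Theory.

Local Open Scope classical_set_scope.
Local Open Scope ring_scope.

(* A subset of P^N(L) is encoded by the set of all its homogeneous coordinate  *)
(* vectors: a set of nonzero rows of length N.+1, stable under scaling.        *)
(* K is the field of definition; iota : K -> L embeds it in an algebraic       *)
(* closure L.  Closedness, irreducibility and dimension refer to the Zariski   *)
(* topology over K (dimension does not change under extension of scalars); in  *)
(* particular varieties are irreducible over K, not necessarily over L.        *)

Section Projective.
Variables (K : fieldType) (L : closedFieldType) (iota : {rmorphism K -> L}).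
Variable N : nat.

Definition proj_eval (p : {mpoly K[N.+1]}) (y : 'rV[L]_N.+1) : L :=
  (map_mpoly iota p).@[y 0].

Definition proj_zeros (S : set {mpoly K[N.+1]}) : set 'rV[L]_N.+1 :=
  [set y : 'rV[L]_N.+1 | y != 0 /\ forall p, S p -> proj_eval p y = 0].

Definition zariski_closed (Z : set 'rV[L]_N.+1) : Prop :=
  exists2 S : set {mpoly K[N.+1]},
    (forall p, S p -> exists d : nat, p \is d.-homog) & Z = proj_zeros S.

Definition projective_subvariety (Z : set 'rV[L]_N.+1) : Prop :=
  [/\ zariski_closed Z, Z !=set0 &
      forall A B, zariski_closed A -> zariski_closed B ->
        Z `<=` A `|` B -> Z `<=` A \/ Z `<=` B].

(* Krull dimension, as an extended real so that dim set0 = -oo (the supremum   *)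
(* of the empty set).                                                          *)
Definition proj_dim (RR : realType) (Z : set 'rV[L]_N.+1) : \bar RR :=
  ereal_sup [set (l%:R%:E : \bar RR) | l in [set l : nat |
    exists2 C : 'I_l.+1 -> set 'rV[L]_N.+1,
      (forall k, projective_subvariety (C k) /\ C k `<=` Z) &
      (forall k k' : 'I_l.+1, (k < k')%N -> C k `<` C k')]].

(* h = dim_K (K[y_0, .., y_N]_d / I(Y)_d). *)
Definition hilbert_value (Y : set 'rV[L]_N.+1) (d h : nat) : Prop :=
  exists2 I : {vspace dhomog N.+1 K d},
    (forall p : dhomog N.+1 K d,
       p \in I <-> forall y, Y y -> proj_eval p y = 0) &
    (h + \dim I)%N = \dim {: dhomog N.+1 K d}.

(* The Hilbert polynomial of Y has leading term (Delta / n!) 'X^n. *)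
Definition has_degree (Y : set 'rV[L]_N.+1) (n Delta : nat) : Prop :=
  exists P : {poly rat},
    [/\ size P = n.+1, lead_coef P = Delta%:R / n`!%:R &
        exists d0 : nat, forall d : nat, (d0 <= d)%N ->
          exists2 h : nat, hilbert_value Y d h & h%:R = P.[d%:R]].

Definition coord_hyperplane (i : 'I_N.+1) : set 'rV[L]_N.+1 :=
  [set y : 'rV[L]_N.+1 | y != 0 /\ y 0 i = 0].

(* In \bar RR, k / (n - -oo) = k / +oo = 0. *)
Definition distributive_constant (RR : realType) (Y : set 'rV[L]_N.+1)
    (q : nat) (D : 'I_q -> set 'rV[L]_N.+1) : \bar RR :=
  (\big[maxe/-oo]_(J : {set 'I_q} | (0 < #|J|)%N)
     (#|J|%:R%:E /
      (proj_dim RR Y -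
       proj_dim RR (Y `&` [set y | forall j, j \in J -> D j y]))))%E.

End Projective.

Definition irreducible_elt (A : unitRingType) (a : A) : Prop :=
  [/\ a != 0, a \isn't a GRing.unit &
      forall b b' : A, a = b * b' -> b \is a GRing.unit \/ b' \is a GRing.unit].

(* The variable u_ij of the Chow form is 'X_(mxvec_index i j), i being the     *)
(* block and j the position in the block.                                      *)

Section Chow.
Variables (K : fieldType) (N n : nat).
Implicit Type F : {mpoly K[n.+1 * N.+1]}.

Definition block_homog (Delta : nat) (i : 'I_n.+1) F : Prop :=
  forall x, x \in msupp F ->
    (\sum_(j < N.+1) x (mxvec_index i j))%N = Delta.

Definition chow_form (L : closedFieldType) (iota : {rmorphism K -> L})
    (Y : set 'rV[L]_N.+1) (Delta : nat) F : Prop :=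
  [/\ irreducible_elt F,
      forall i, block_homog Delta i F &
      forall U : 'M[L]_(n.+1, N.+1),
        (map_mpoly iota F).@[mxvec U 0] = 0 <->
        exists2 y, Y y & forall i, \sum_(j < N.+1) U i j * y 0 j = 0].

Variables (RR : realType) (c : 'I_N.+1 -> RR).

(* u_ij |-> t^(c_j) u_ij multiplies the monomial 'X_[x] by t^(t_exponent x). *)
Definition t_exponent (x : 'X_{1..n.+1 * N.+1}) : RR :=
  \sum_(i < n.+1) \sum_(j < N.+1) (x (mxvec_index i j))%:R * c j.

(* The coefficient of t^e in F(.., t^(c_j) u_ij, ..); see t_coefP. *)
Definition t_coef F (e : RR) : {mpoly K[n.+1 * N.+1]} :=
  \sum_(x <- msupp F | t_exponent x == e) F@_x *: 'X_[x].

(* The set is finite, and nonempty when F != 0, so sup is its maximum. *)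
Definition chow_weight F : RR := sup [set e : RR | t_coef F e != 0].

(* tau plays the role of the formal power e |-> t^e. *)
Lemma t_coefP (A : comNzRingType) (f : {rmorphism K -> A}) (tau : RR -> A)
    (v : 'M[A]_(n.+1, N.+1)) F :
  tau 0 = 1 -> {morph tau : a b / a + b >-> a * b} ->
  (map_mpoly f F).@[mxvec (\matrix_(i, j) (tau (c j) * v i j)) 0] =
  \sum_(e <- undup [seq t_exponent x | x <- msupp F])
     tau e * (map_mpoly f (t_coef F e)).@[mxvec v 0].
Proof.
move=> tau0 tauD.
have tauMn k a : tau (k%:R * a) = tau a ^+ k.
  elim: k => [|k IHk]; first by rewrite mul0r tau0 expr0.
  by rewrite -natr1 mulrDl mul1r tauD IHk exprSr.
have tau_exp x : tau (t_exponent x) =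
    \prod_(i < n.+1) \prod_(j < N.+1) tau (c j) ^+ x (mxvec_index i j).
  rewrite (big_morph tau tauD tau0); apply: eq_bigr => i _.
  by rewrite (big_morph tau tauD tau0); apply: eq_bigr => j _.
have evalX (w : 'M[A]_(n.+1, N.+1)) x :
    mmap1 (mxvec w 0) x =
    \prod_(i < n.+1) \prod_(j < N.+1) w i j ^+ x (mxvec_index i j).
  rewrite pair_bigA /mmap1.
  rewrite (reindex _ (curry_mxvec_bij _ _)) /=.
  by apply: eq_big => [|[i j] _] /=; rewrite ?mxvecE.
have evalE (w : 'M[A]_(n.+1, N.+1)) G :
    (map_mpoly f G).@[mxvec w 0] = mmap f (mxvec w 0) G.
  have -> : map_mpoly f G = \sum_(x <- msupp G) f G@_x *: 'X_[x].
    by apply: eq_bigr => x _; rewrite mmap1_id mul_mpolyC.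
  by rewrite raddf_sum; apply: eq_bigr => x _; rewrite /= mevalZ mevalX.
have evalT e : (map_mpoly f (t_coef F e)).@[mxvec v 0] =
    \sum_(x <- msupp F | t_exponent x == e) f F@_x * mmap1 (mxvec v 0) x.
  rewrite /t_coef (raddf_sum (map_mpoly f)) raddf_sum; apply: eq_bigr => x _.
  by rewrite /= map_mpolyZ map_mpolyX mevalZ mevalX.
under [RHS]eq_bigr do rewrite evalT mulr_sumr.
rewrite (exchange_big_dep xpredT) //= evalE /mmap; apply: eq_big_seq => x xF.
rewrite -big_filter (_ : [seq e <- _ | _] = [:: t_exponent x]); last first.
  apply: perm_small_eq => //; apply: uniq_perm => // [|e].
    by rewrite filter_uniq ?undup_uniq.
  rewrite mem_filter mem_undup inE eq_sym; apply: andb_idr => /eqP <-.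
  exact: map_f.
rewrite big_seq1 mulrCA; congr (_ * _); rewrite tau_exp !evalX -big_split /=.
apply: eq_bigr => i _; rewrite -big_split; apply: eq_bigr => j _ /=.
by rewrite mxE exprMn.
Qed.

End Chow.

(* Main.v *)
Require Import Defs.
From HB Require Import structures.
From mathcomp Require Import all_boot all_order all_algebra all_field.
From mathcomp Require Import mpoly.
From mathcomp Require Import boolp classical_sets reals constructive_ereal ereal.
From mathcomp Require Import zify ring lra.

Set Implicit Arguments.
Unset Strict Implicit.
Unset Printing Implicit Defensive.

Import Order.TTheory GRing.Theory Num.Theory.

Local Open Scope classical_set_scope.
Local Open Scope ring_scope.

(* Order the indices so that c(i_0) >= ... >= c(i_m), and let t_s be the least *)
(* t such that Y cut by the hyperplanes H_(i_0), .., H_(i_t) has dimension     *)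
(* < n - s.  Since a form that vanishes on no component of maximal dimension   *)
(* lowers the dimension, one finds linear forms L_0, .., L_n, with L_s in the  *)
(* span of y_(i_0), .., y_(i_(t_s)), without common zero on Y.  Thus F_Y does  *)
(* not vanish at (L_0, .., L_n) and has a monomial whose s-th block only       *)
(* involves the variables u_(s, i_j) with j <= t_s, so that                    *)
(* e_Y(c) >= Delta * (c(i_(t_0)) + .. + c(i_(t_n))).                           *)
(* The distributive constant gives t_s <= delta * s, and the projective        *)
(* dimension theorem (d forms meet every closed set of dimension d) gives      *)
(* delta >= 1 and t_s + n <= m + s; an Abel summation then concludes.          *)
(* The dimension theorem holds because a chain of length d provides d + 1      *)
(* algebraically independent polynomial functions on the last term of the      *)
(* chain, whereas by the Nullstellensatz d linear forms without common zero    *)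
(* make the coordinate ring a finite module over polynomials in d variables.   *)

(** * Nullstellensatz *)

(** Throughout, dim Z >= l is expressed by [irreducible_chain iota Z l], and dim Z < l by its
    negation. Two results pull in opposite directions. [chain_meets_forms] says that d linear forms
    always meet a set of dimension at least d; hence each hyperplane lowers the dimension by at most
    one ([chain_hyperplane_section]), and a section by few of the H_(i_j) cannot be too small, nor
    one by many of them too large, as all of them together miss Y. Conversely [cut_by_forms]
    produces n + 1 forms without common zero on Y, the s-th one supported on the first t_s + 1
    coordinates, which [chow_weight_lower_bound] turns into a monomial of large exponent.
    [distributive_constantP] restates the distributive constant in terms of chains, and
    [weighted_selection] is the remaining inequality between real numbers. *)

Lemma poly_natr_neq0 (F : fieldType) (p : {poly F}) :
  [pchar F] =i pred0 -> p != 0 -> exists t : nat, p.[t%:R] != 0.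
Proof.
move=> /pcharf0P char0 p0; apply: contrapT => /forallNP hp.
suff : (size [seq (t%:R : F) | t <- iota 0 (size p)] < size p)%N.
  by rewrite size_map size_iota ltnn.
apply: max_poly_roots => //.
  by apply/allP => _ /mapP[t _ ->]; rewrite rootE; apply/negPn/negP/hp.
rewrite map_inj_in_uniq ?iota_uniq // => t u _ _ /eqP.
wlog tu : t u / (t <= u)%N => [th|].
  by case/orP: (leq_total t u) => /th // H; rewrite eq_sym => /H.
by rewrite eq_sym -subr_eq0 -natrB // char0 => /eqP; lia.
Qed.

(** If [u] works for a tail and [v] for the head, then [u + v *+ t] works for all but finitely many
    natural numbers [t]. Natural multiples are enough in characteristic 0, so [P] need only be
    stable under addition. *)
Lemma simultaneous_nonvanishing (V : zmodType) (F : fieldType) (T : eqType)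
    (phi : T -> {additive V -> F}) (P : V -> Prop) (s : seq T) :
    [pchar F] =i pred0 -> P 0 -> (forall u v, P u -> P v -> P (u + v)) ->
    (forall x, x \in s -> exists2 v, P v & phi x v != 0) ->
  exists2 v, P v & forall x, x \in s -> phi x v != 0.
Proof.
move=> char0 P0 PD; elim: s => [|x s IHs] hs; first by exists 0.
have [y ys|u Pu hu] := IHs; first by apply: hs; rewrite inE ys orbT.
have [v Pv hv] := hs x (mem_head _ _).
have [|t] := @poly_natr_neq0 _
    (\prod_(y <- x :: s) ((phi y u)%:P + (phi y v) *: 'X)) char0.
  rewrite prodf_seq_neq0; apply/allP => y; rewrite inE /= => ys.
  apply/eqP => /polyP h; have := h 0; have := h 1.
  rewrite !(coefD, coefC, coefZ, coefX, coef0) /= mulr1 mulr0 addr0 add0r.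
  case/orP: ys => [/eqP->|/hu /eqP //].
  by move/eqP: hv.
rewrite horner_prod prodf_seq_neq0 => /allP /= h.
exists (u + v *+ t) => [|y ys].
  apply: (PD) => //; elim: t {h} => [|t IHt]; first by rewrite mulr0n.
  by rewrite mulrS; apply: PD.
by have := h y ys; rewrite !hornerE raddfD raddfMn /= mulr_natr.
Qed.

Lemma map_resultant_morph (R S : nzRingType) (f : {rmorphism R -> S})
    (p q : {poly R}) : f (lead_coef p) != 0 -> f (lead_coef q) != 0 ->
  f (resultant p q) = resultant (map_poly f p) (map_poly f q).
Proof.
move=> fp fq; rewrite /resultant /Sylvester_mx !size_map_poly_id0 //.
rewrite -det_map_mx map_col_mx; congr (\det (col_mx _ _));
  by apply: map_lin1_mx => v; rewrite map_poly_rV rmorphM /= map_rVpoly.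
Qed.

(** Recovers exponents from a weight in base [w]; this makes the weights in [nagata_lead]
    injective. *)
Lemma digit_sum (w n : nat) (a : 'I_n -> nat) (j : 'I_n) :
    (forall i, a i < w)%N ->
  ((\sum_(i < n) a i * w ^ i) %/ w ^ j %% w = a j)%N.
Proof.
elim: n a j => [|n IHn] a; first by case.
move=> j aw; have w_gt0 : (0 < w)%N by apply: leq_ltn_trans (aw ord0).
rewrite big_ord_recl expn0 muln1.
have -> : (\sum_(i < n) a (lift ord0 i) * w ^ lift ord0 i =
           (\sum_(i < n) a (lift ord0 i) * w ^ i) * w)%N.
  by rewrite big_distrl; apply: eq_bigr => i _; rewrite lift0 expnSr mulnA.
have [j' ->|->] := unliftP ord0 j.
  rewrite lift0 expnS divnMA addnC divnMDl // (divn_small (aw ord0)) addn0.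
  exact: (IHn (fun i => a (lift ord0 i))).
by rewrite expn0 divn1 addnC modnMDl modn_small.
Qed.

Lemma rmorph_mmap n (R : nzRingType) (S T : comNzRingType)
    (g : {rmorphism S -> T}) (h : {rmorphism R -> S}) (v : 'I_n -> S) p :
  g (mmap h v p) = mmap (g \o h) (g \o v) p.
Proof.
rewrite /mmap rmorph_sum; apply: eq_bigr => a _.
rewrite rmorphM; congr (_ * _); rewrite /mmap1 rmorph_prod.
by apply: eq_bigr => i _; rewrite rmorphXn.
Qed.

Section Nagata.
Variables (K : fieldType) (n w : nat).

(* Nagata's change of variables: for [w] larger than all exponents of [p], *)
(* distinct monomials of [p] get distinct degrees in ['X], so that         *)
(* [nagata p] is monic up to a nonzero constant.                           *)
Definition nagata_var (i : 'I_n.+1) : {poly {mpoly K[n]}} :=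
  'X^(w ^ i) + (oapp (fun j => 'X_j) 0 (unlift ord0 i))%:P.

Definition nagata (p : {mpoly K[n.+1]}) : {poly {mpoly K[n]}} :=
  mmap (polyC \o @mpolyC n K) nagata_var p.

Definition nagata_eval (A : comNzRingType) (f : {rmorphism K -> A})
    (x : 'I_n -> A) (t : A) (q : {poly {mpoly K[n]}}) : A :=
  (map_poly (mmap f x) q).[t].

Lemma nagata_evalD (A : comNzRingType) (f : {rmorphism K -> A}) x t p q :
  nagata_eval f x t (p + q) = nagata_eval f x t p + nagata_eval f x t q.
Proof. by rewrite /nagata_eval rmorphD hornerD. Qed.

Lemma nagata_evalM (A : comNzRingType) (f : {rmorphism K -> A}) x t p q :
  nagata_eval f x t (p * q) = nagata_eval f x t p * nagata_eval f x t q.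
Proof. by rewrite /nagata_eval rmorphM hornerM. Qed.

Lemma nagata_evalC (A : comNzRingType) (f : {rmorphism K -> A}) x t p :
  nagata_eval f x t p%:P = mmap f x p.
Proof. by rewrite /nagata_eval map_polyC hornerC. Qed.

Lemma nagataK (A : comNzRingType) (f : {rmorphism K -> A}) x t p :
  nagata_eval f x t (nagata p) =
  mmap f (fun i : 'I_n.+1 => t ^+ (w ^ i) + oapp x 0 (unlift ord0 i)) p.
Proof.
pose g : {rmorphism {poly {mpoly K[n]}} -> A} :=
  horner_eval t \o map_poly (mmap f x).
rewrite /nagata -[LHS]/(g _) rmorph_mmap /mmap; apply: eq_bigr => a _.
congr (_ * _); first by rewrite /= map_polyC /= mmapC /horner_eval hornerC.
apply: mmap1_eq => i /=; rewrite /nagata_var /horner_eval rmorphD /= map_polyXn.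
rewrite map_polyC /= hornerD hornerXn hornerC; congr (_ + _).
by case: (unlift ord0 i) => [j|] /=; rewrite ?mmapX ?mmap1U ?mmap0.
Qed.

Lemma nagata_var_monic i : (0 < w)%N ->
  (nagata_var i \is monic) /\ size (nagata_var i) = (w ^ i).+1.
Proof.
move=> w0; have sC c : (size (c%:P : {poly {mpoly K[n]}})
    < size ('X^(w ^ i) : {poly {mpoly K[n]}}))%N.
  by rewrite size_polyXn (leq_ltn_trans (size_polyC_leq1 _)) // ltnS expn_gt0 w0.
by rewrite monicE lead_coefDl // size_polyDl // size_polyXn lead_coefXn.
Qed.

Lemma nagata_mon_monic (a : 'X_{1..n.+1}) : (0 < w)%N ->
  (mmap1 nagata_var a \is monic) /\
  size (mmap1 nagata_var a) = (\sum_i a i * w ^ i).+1.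
Proof.
move=> w0; rewrite /mmap1.
elim/big_rec2: _ => [|i d p _ [pm ps]]; first by rewrite monic1 size_poly1.
have [vm vs] := nagata_var_monic i w0.
have vam : nagata_var i ^+ a i \is monic by rewrite monic_exp.
split; first by rewrite monicMl.
rewrite size_monicM ?monic_neq0 // ps.
suff -> : size (nagata_var i ^+ a i) = (a i * w ^ i).+1 by rewrite addSn addnS.
elim: (a i) => [|k IHk]; first by rewrite size_poly1.
rewrite exprS size_monicM ?monic_neq0 ?monic_exp // vs IHk mulSn.
by rewrite addSn addnS.
Qed.

(** The weights [wt a] are expansions in base [w], hence distinct on the support; the monomial of
    greatest weight alone provides the leading term, and [c] inverts its coefficient. *)
Lemma nagata_lead (p : {mpoly K[n.+1]}) : p != 0 ->
    (forall a i, a \in msupp p -> a i < w)%N ->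
  exists2 c : K, c != 0 & c%:MP%:P * nagata p \is monic.
Proof.
move=> p0 hw.
have /hasP[a0 a0p _] : has predT (msupp p).
  by rewrite has_predT lt0n size_eq0 msupp_eq0.
have w0 : (0 < w)%N by apply: leq_ltn_trans (hw a0 ord0 a0p).
pose wt (a : 'X_{1..n.+1}) := (\sum_i a i * w ^ i)%N.
have wt_inj a b : a \in msupp p -> b \in msupp p -> wt a = wt b -> a = b.
  move=> ap bp ab; apply/mnmP => i.
  rewrite -(digit_sum i (fun i => hw a i ap)) -(digit_sum i (fun i => hw b i bp)).
  by rewrite -/(wt a) -/(wt b) ab.
have [a ap amax] : exists2 a, a \in msupp p &
    forall b, b \in msupp p -> (wt b <= wt a)%N.
  have := @arg_maxnP _ (Ordinal (etrans (index_mem a0 (msupp p)) a0p)) xpredT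
    (fun k : 'I_(size (msupp p)) => wt (nth a0 (msupp p) k)) isT.
  case=> k _ hk; exists (nth a0 (msupp p) k); first by rewrite mem_nth.
  move=> b bp; have kb := etrans (index_mem b (msupp p)) bp.
  by have := hk (Ordinal kb) isT; rewrite /= nth_index.
have pa0 : p@_a != 0 by rewrite mcoeff_eq0 ap.
exists (p@_a)^-1; first by rewrite invr_eq0.
have -> : (p@_a)^-1%:MP%:P * nagata p = mmap1 nagata_var a +
    \sum_(b <- rem a (msupp p)) ((p@_a)^-1 * p@_b)%:MP%:P * mmap1 nagata_var b.
  rewrite /nagata /mmap (big_rem a ap) /= mulrDr mulrA -!rmorphM /=.
  rewrite mulVf // !rmorph1 mul1r mulr_sumr; congr (_ + _).
  by apply: eq_bigr => b _; rewrite mulrA -!rmorphM.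
have [am asz] := nagata_mon_monic a w0.
rewrite monicE lead_coefDl -?monicE //.
rewrite asz ltnS; apply: leq_trans (size_sum _ _ _) _.
rewrite big_seq; apply/bigmax_leqP_seq => b; rewrite (mem_rem_uniq _ (msupp_uniq _)).
rewrite inE => /andP[ba bp] _.
have [_ bsz] := nagata_mon_monic b w0.
rewrite mul_polyC; apply: leq_trans (size_scale_leq _ _) _; rewrite bsz.
rewrite -/(wt a) -/(wt b) ltn_neqAle amax // andbT.
by apply: contra ba => /eqP /wt_inj ->.
Qed.

End Nagata.

Definition is_ideal (A : comNzRingType) (I : A -> Prop) : Prop :=
  [/\ I 0, forall a b, I a -> I b -> I (a + b) & forall a b, I b -> I (a * b)].

(* The points are the zeros, in an algebraically closed extension, of the  *)
(* preimage of [I] in [K[X_1, .., X_n]]; letting [x] vary absorbs changes  *)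
(* of variables in the induction on [n].                                   *)
Lemma weak_nullstellensatz (K : fieldType) (L : closedFieldType)
    (iota : {rmorphism K -> L}) (A : comNzRingType) (f : {rmorphism K -> A})
    (n : nat) (x : 'I_n -> A) (I : A -> Prop) :
    [pchar L] =i pred0 -> is_ideal I -> ~ I 1 ->
  exists a : 'I_n -> L, forall p, I (mmap f x p) -> mmap iota a p = 0.
Proof.
move=> char0 [I0 ID IM] I1.
elim: n x => [|n IHn] x.
  exists (fun=> 0) => p; have [c ->] : exists c, p = c%:MP.
    exists p@_0; apply/mpolyP => m; rewrite mcoeffC.
    have -> : m = 0%MM by apply/mnmP; case.
    by rewrite eqxx mulr1.
  rewrite !mmapC; have [->|c0] := eqVneq c 0; first by rewrite !raddf0.
  by move=> /(IM (f c^-1)); rewrite -rmorphM mulVf // rmorph1 => /I1.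
(* Without a nonzero relation among the [x i] modulo [I], every point will do. *)
case: (pselect (exists2 g, g != 0 & I (mmap f x g))) => [[g g0 Ig]|no]; last first.
  exists (fun=> 0) => p Ip; suff -> : p = 0 by rewrite mmap0.
  by apply/eqP; apply: contrapT => /negP p0; apply: no; exists p.
pose w := msize g.
have hw a i : a \in msupp g -> (a i < w)%N.
  move=> /msize_mdeg_lt; apply: leq_ltn_trans.
  by rewrite mdegE (bigD1 i) //= leq_addr.
(* Inverse change of variables: evaluating [nagata w p] at [y] and [t] gives back [p] at [x]. *)
pose t := x ord0; pose y (j : 'I_n) := x (lift ord0 j) - t ^+ (w ^ lift ord0 j).
have [a ha] := IHn y.
have evA p : nagata_eval f y t (nagata w p) = mmap f x p.
  rewrite nagataK /mmap; apply: eq_bigr => b _; congr (_ * _).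
  apply: mmap1_eq => i; have [j ->|->] := unliftP ord0 i => /=.
    by rewrite /y addrC subrK.
  by rewrite expn0 expr1 addr0.
have [c c0 Gm] := nagata_lead g0 hw.
set G := _ * _ in Gm.
have IG : I (nagata_eval f y t G).
  by rewrite /G nagata_evalM evA; apply: IM.
have szG : (1 < size G)%N.
  rewrite ltnNge; apply/negP => /size1_polyC eG; apply: I1.
  move: Gm IG; rewrite eG monicE lead_coefC => /eqP ->.
  by rewrite polyC1 /nagata_eval rmorph1 hornerC.
pose E (b : L) : {rmorphism {poly {mpoly K[n]}} -> L} :=
  horner_eval b \o map_poly (mmap iota a).
suff [b hb] : exists b, forall q, I (nagata_eval f y t q) -> E b q = 0.
  exists (fun i : 'I_n.+1 => b ^+ (w ^ i) + oapp a 0 (unlift ord0 i)) => p Ip.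
  by rewrite -nagataK; apply: (hb (nagata w p)); rewrite evA.
pose Ga := map_poly (mmap iota a) G.
have [r Gr] := closed_field_poly_normal Ga.
(* Otherwise each root of [Ga] has a member of the ideal that does not vanish there, and
   [simultaneous_nonvanishing] yields a single [q] vanishing at no root of [Ga]. *)
apply: contrapT => /forallNP nob.
have [||b br|q Iq qr] := @simultaneous_nonvanishing _ L _ E
    (fun q => I (nagata_eval f y t q)) r char0.
- by rewrite /nagata_eval rmorph0 horner0.
- by move=> u v Iu Iv; rewrite nagata_evalD; apply: ID.
- have /existsNP[q /not_implyP[Iq /eqP q0]] := nob b.
  by exists q.
(* [q'] agrees with [q] at the roots of [G], but it is monic, so that the *)
(* resultant with [G] commutes with the evaluation at [a].                *)
pose q' := q + G * 'X^(size q).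
have szGX : size (G * 'X^(size q))%R = (size G + size q)%N.
  by rewrite size_monicM ?monic_neq0 ?monicXn // size_polyXn addnS.
have szq : (size q < size (G * 'X^(size q))%R)%N.
  by rewrite szGX -[X in (X < _)%N]add0n ltn_add2r; apply: leq_trans szG.
have q'm : q' \is monic.
  have GX : G * 'X^(size q) \is monic by rewrite (monicMl _ Gm) monicXn.
  by rewrite monicE lead_coefDr // (monicP GX).
have szq' : (1 < size q')%N.
  rewrite /q' addrC size_polyDl //; apply: leq_trans szG _.
  by rewrite szGX leq_addr.
have Iq' : I (nagata_eval f y t q').
  by rewrite nagata_evalD; apply: ID => //; rewrite nagata_evalM mulrC; apply: IM.
(* The resultant is a combination of [q'] and [G] free of the last variable, so it vanishes at [a].
   The two specializations then share a root, at which [q] vanishes as well. *)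
have [[u v] _ /= Ruv] := resultant_in_ideal szq' szG.
have R0 : mmap iota a (resultant q' G) = 0.
  apply: ha; rewrite -(nagata_evalC _ _ t) Ruv nagata_evalD (nagata_evalM _ _ _ u) (nagata_evalM _ _ _ v).
  by apply: (ID); apply: (IM).
move/eqP: R0; rewrite map_resultant_morph ?(monicP Gm) ?(monicP q'm) ?rmorph1 ?oner_neq0 //.
rewrite resultant_eq0 => szgcd.
have /closed_rootP[b] : size (gcdp (map_poly (mmap iota a) q')
     (map_poly (mmap iota a) G)) != 1%N by rewrite neq_ltn szgcd orbT.
rewrite root_gcd => /andP[bq' bG].
have br : b \in r.
  have Gam : Ga \is monic by rewrite monic_map.
  by move: bG; rewrite -/Ga Gr (monicP Gam) scale1r root_prod_XsubC.
have Eq := qr b br.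
have EG : E b G = 0 by apply/eqP.
have : E b q' = 0 by apply/eqP.
by rewrite /q' rmorphD (rmorphM (E b) G) EG mul0r addr0 => h; move/eqP: Eq; apply.
Qed.

(** * Evaluation at homogeneous coordinates *)

Section Evaluation.
Variables (K : fieldType) (L : closedFieldType) (iota : {rmorphism K -> L}).
Variable N : nat.
Implicit Types (p q : {mpoly K[N.+1]}) (y : 'rV[L]_N.+1) (Z C : set 'rV[L]_N.+1).

Lemma proj_evalE p y : proj_eval iota p y = mmap iota (y 0) p.
Proof.
rewrite /proj_eval /map_mpoly.
rewrite (rmorph_mmap (meval (y 0)) (@mpolyC N.+1 L \o iota)) /mmap.
apply: eq_bigr => a _; congr (_ * _); first by rewrite /= mevalC.
by apply: mmap1_eq => j /=; rewrite mevalXU.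
Qed.

Lemma proj_evalD p q y :
  proj_eval iota (p + q) y = proj_eval iota p y + proj_eval iota q y.
Proof. by rewrite !proj_evalE rmorphD. Qed.

Lemma proj_evalB p q y :
  proj_eval iota (p - q) y = proj_eval iota p y - proj_eval iota q y.
Proof. by rewrite !proj_evalE rmorphB. Qed.

Lemma proj_evalM p q y :
  proj_eval iota (p * q) y = proj_eval iota p y * proj_eval iota q y.
Proof. by rewrite !proj_evalE rmorphM. Qed.

Lemma proj_evalZ c p y : proj_eval iota (c *: p) y = iota c * proj_eval iota p y.
Proof. by rewrite !proj_evalE mmapZ. Qed.

Lemma proj_eval0 y : proj_eval iota 0 y = 0.
Proof. by rewrite proj_evalE rmorph0. Qed.

Lemma proj_eval1 y : proj_eval iota 1 y = 1.
Proof. by rewrite proj_evalE rmorph1. Qed.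

Lemma proj_evalXn p k y : proj_eval iota (p ^+ k) y = proj_eval iota p y ^+ k.
Proof. by rewrite !proj_evalE rmorphXn. Qed.

Lemma proj_evalU j y : proj_eval iota 'X_j y = y 0 j.
Proof. by rewrite proj_evalE mmapX mmap1U. Qed.

Lemma proj_eval_sum (I : Type) (r : seq I) (P : pred I) (F : I -> {mpoly K[N.+1]}) y :
  proj_eval iota (\sum_(i <- r | P i) F i) y =
  \sum_(i <- r | P i) proj_eval iota (F i) y.
Proof. by rewrite proj_evalE rmorph_sum; apply: eq_bigr => i _; rewrite proj_evalE. Qed.

Lemma proj_eval_monE (a : 'X_{1..N.+1}) y :
  proj_eval iota 'X_[a] y = \prod_i y 0 i ^+ a i.
Proof. by rewrite proj_evalE mmapX. Qed.

Lemma proj_eval_scale_mon (a : 'X_{1..N.+1}) t y :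
  proj_eval iota 'X_[a] (t *: y) = t ^+ mdeg a * proj_eval iota 'X_[a] y.
Proof.
rewrite !proj_eval_monE mdegE expr_sum -big_split /=.
by apply: eq_bigr => i _; rewrite mxE exprMn.
Qed.

Lemma proj_eval_homog d p t y : p \is d.-homog ->
  proj_eval iota p (t *: y) = t ^+ d * proj_eval iota p y.
Proof.
move=> /dhomogP pd; rewrite (mpolyE p) !proj_eval_sum mulr_sumr.
rewrite big_seq [RHS]big_seq; apply: eq_bigr => a /pd <-.
by rewrite !proj_evalZ proj_eval_scale_mon mulrCA.
Qed.

Definition vanishing Z p : Prop := forall y, Z y -> proj_eval iota p y = 0.

Lemma vanishing_ideal Z : is_ideal (vanishing Z).
Proof.
split=> [y _|p q hp hq y Zy|p q hq y Zy]; first exact: proj_eval0.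
  by rewrite proj_evalD hp // hq // addr0.
by rewrite proj_evalM hq // mulr0.
Qed.

Lemma zariski_closed_neq0 Z y : zariski_closed iota Z -> Z y -> y != 0.
Proof. by case=> S _ -> []. Qed.

Lemma zariski_closed_scale Z y t : zariski_closed iota Z -> t != 0 -> Z y ->
  Z (t *: y).
Proof.
case=> S hS -> t0 [y0 Sy]; split; first by rewrite scaler_eq0 negb_or t0.
move=> p Sp; have [d pd] := hS p Sp.
by rewrite (proj_eval_homog _ _ pd) Sy // mulr0.
Qed.

Lemma zariski_closed_witness Z y : zariski_closed iota Z -> y != 0 -> ~ Z y ->
  exists d p, [/\ p \is d.-homog, vanishing Z p & proj_eval iota p y != 0].
Proof.
case=> S hS -> y0 nZy; apply: contrapT => no; apply: nZy; split => // p Sp.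
apply/eqP; apply: contrapT => /negP py; apply: no.
by have [d pd] := hS p Sp; exists d, p; split => // z [_]; apply.
Qed.

Lemma zariski_closed_zero d p : p \is d.-homog ->
  zariski_closed iota [set y | y != 0 /\ proj_eval iota p y = 0].
Proof.
move=> pd; exists [set p] => [_ ->|]; first by exists d.
by apply/seteqP; split=> y /= [y0 h]; split=> //; [move=> _ -> | apply: h].
Qed.

Lemma zariski_closedI Z Z' : zariski_closed iota Z -> zariski_closed iota Z' ->
  zariski_closed iota (Z `&` Z').
Proof.
case=> S hS -> [S' hS' ->]; exists (S `|` S') => [p [/hS|/hS'] //|].
apply/seteqP; split=> [y [[y0 Sy] [_ S'y]]|y [y0 h]].
  by split=> // p [/Sy|/S'y].
by split; split=> // p hp; apply: h; [left | right].
Qed.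

Lemma proj_evalE_pihomog p k y : (msize p <= k)%N ->
  proj_eval iota p y = \sum_(d < k) proj_eval iota (pihomog mdeg d p) y.
Proof.
by move=> pk; rewrite {1}(pihomog_partitionE pk) proj_eval_sum.
Qed.

Hypothesis char0 : [pchar L] =i pred0.

(** On the line through [y], [p] is a polynomial in the scaling factor whose coefficients are the
    values of its homogeneous parts; it has infinitely many zeros. *)
Lemma vanishing_pihomog Z d p : zariski_closed iota Z -> vanishing Z p ->
  vanishing Z (pihomog mdeg d p).
Proof.
move=> cZ vp y Zy; set k := maxn (msize p) d.+1.
have pk : (msize p <= k)%N by rewrite leq_maxl.
have dk : (d < k)%N by rewrite leq_maxr.
pose P := \poly_(e < k) proj_eval iota (pihomog mdeg e p) y.
suff P0 : P = 0.
  by have := congr1 (fun P : {poly L} => P`_d) P0; rewrite coef_poly dk coef0.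
apply/eqP; apply: contrapT => /negP P0.
(* The factor ['X] forces [t] to be nonzero, since scaling by 0 leaves [Z]. *)
have X0 : P * 'X != 0 by rewrite mulf_neq0 // polyX_eq0.
have [t] := poly_natr_neq0 char0 X0.
rewrite hornerM hornerX mulf_eq0 negb_or => /andP[Pt t0].
move/eqP: Pt; apply; rewrite horner_poly.
rewrite -[RHS](vp (t%:R *: y)); last exact: zariski_closed_scale.
rewrite (proj_evalE_pihomog _ pk); apply: eq_bigr => e _.
by rewrite (proj_eval_homog _ _ (pihomogP _ _ _)) mulrC.
Qed.

Lemma pihomogMl d p k q : p \is d.-homog ->
  pihomog mdeg (d + k) (p * q) = p * pihomog mdeg k q.
Proof.
move=> pd; set m := maxn (msize q) k.+1.
have qm : (msize q <= m)%N by rewrite leq_maxl.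
have km : (k < m)%N by rewrite leq_maxr.
rewrite {1}(pihomog_partitionE qm) mulr_sumr raddf_sum (bigD1 (Ordinal km)) //=.
rewrite pihomog_dE ?dhomogM ?pihomogP // big1 ?addr0 // => e ek.
apply: (@pihomog_ne0 _ _ _ (d + e)); rewrite ?dhomogM ?pihomogP //.
by rewrite eqn_add2l.
Qed.

(** The ideal of an irreducible set is prime. Irreducibility only concerns zeros of forms, so [q] is
    treated one homogeneous component at a time. *)
Lemma vanishing_cancel C d p q : projective_subvariety iota C -> p \is d.-homog ->
  ~ vanishing C p -> vanishing C (p * q) -> vanishing C q.
Proof.
case=> cC _ irrC pd np vpq.
have vq k : vanishing C (pihomog mdeg k q).
  have vk : vanishing C (p * pihomog mdeg k q).
    by rewrite -(pihomogMl _ _ pd); apply: vanishing_pihomog.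
  have := irrC _ _ (zariski_closed_zero pd) (zariski_closed_zero (pihomogP mdeg k q)).
  case=> [y Cy|sub|sub y /sub[] //].
    have y0 := zariski_closed_neq0 cC Cy.
    have /eqP := vk y Cy; rewrite proj_evalM mulf_eq0 => /orP[]/eqP h.
      by left.
    by right.
  by exfalso; apply: np => y /sub[].
by move=> y Cy; rewrite (proj_evalE_pihomog _ (leqnn _)) big1 // => d' _; apply: vq.
Qed.

End Evaluation.

(** * The projective dimension theorem *)

Lemma mmap_muni (K : nzRingType) (A : comNzRingType) (f : {rmorphism K -> A})
    n (x : 'I_n.+1 -> A) p :
  mmap f x p =
  (map_poly (mmap f (x \o widen_ord (leqnSn n))) (muni p)).[x ord_max].
Proof.
rewrite muniE rmorph_sum horner_sum /mmap; apply: eq_bigr => a _.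
rewrite -mul_polyC rmorphM /= map_polyC map_polyXn hornerM hornerC hornerXn.
rewrite /= mmapZ mmapX -mulrA.
congr (_ * _); rewrite /mmap1 big_ord_recr /=; congr (_ * _).
by apply: eq_bigr => i _; rewrite mnmE.
Qed.

Lemma mmap_id n (K : comNzRingType) (p : {mpoly K[n]}) :
  mmap (@mpolyC n K) (fun i => 'X_i) p = p.
Proof.
rewrite {2}(mpolyE p) /mmap; apply: eq_bigr => a _.
by rewrite mmap1_id mul_mpolyC.
Qed.

Lemma muni_eq0 n (K : comNzRingType) (p : {mpoly K[n.+1]}) : muni p = 0 -> p = 0.
Proof. by move=> p0; rewrite -[p]mmap_id mmap_muni p0 rmorph0 horner0. Qed.

(** Write a relation as p * x_r + c, with c free of the last variable. As x_r lies in [Q r], so does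
    the value of c, and c = 0 by induction on [r]; then x_r is cancelled modulo [Q r.+1] and the
    degree in x_r drops. *)
Lemma tower_independent (K : fieldType) (A : comNzRingType)
    (f : {rmorphism K -> A}) r (Q : nat -> A -> Prop) (x : 'I_r -> A) :
    (forall k, is_ideal (Q k)) -> ~ Q 0 1 ->
    (forall k a, Q k.+1 a -> Q k a) ->
    (forall k : 'I_r, Q k (x k)) ->
    (forall (k : 'I_r) a, Q k.+1 (a * x k) -> Q k.+1 a) ->
  forall p, Q r (mmap f x p) -> p = 0.
Proof.
move=> idQ Q01 QS; elim: r x => [|r IHr] x Qx Qcancel p.
  have [c ->] : exists c, p = c%:MP.
    exists p@_0; apply/mpolyP => m; rewrite mcoeffC.
    have -> : m = 0%MM by apply/mnmP; case.
    by rewrite eqxx mulr1.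
  rewrite mmapC; have [->|c0] := eqVneq c 0; first by rewrite raddf0.
  have [_ _ QM] := idQ 0.
  by move=> /(QM (f c^-1)); rewrite -rmorphM mulVf // rmorph1 => /Q01.
pose y := x \o widen_ord (leqnSn r).
have IH q : Q r (mmap f y q) -> q = 0.
  apply: IHr => k; first exact: (Qx (widen_ord (leqnSn r) k)).
  exact: (Qcancel (widen_ord (leqnSn r) k)).
rewrite mmap_muni => hp; apply: muni_eq0; move: (muni p) hp => {}p.
elim/poly_ind: p => [//|p c IHp].
rewrite rmorphD rmorphM /= map_polyX map_polyC /= hornerMXaddC => hp.
have [_ QD QM] := idQ r.
have c0 : c = 0.
  apply: IH; rewrite -[mmap _ _ c](addKr (((map_poly (mmap f y)) p).[x ord_max] * x ord_max)).
  apply: (QD) (QS _ _ hp); rewrite -mulNr.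
  by apply: (QM); apply: (Qx ord_max).
move: hp; rewrite c0 rmorph0 addr0 => /(Qcancel ord_max) /IHp ->.
by rewrite mul0r addr0.
Qed.

Definition is_submodule (K : nzRingType) (V : lmodType K) (J : V -> Prop) : Prop :=
  [/\ J 0, forall u v, J u -> J v -> J (u + v) & forall c v, J v -> J (c *: v)].

Definition spanned_mod (K : nzRingType) (V : lmodType K) (J : V -> Prop)
    (T : finType) (B : T -> V) (v : V) : Prop :=
  exists w : T -> K, J (v - \sum_t w t *: B t).

Section Spanned.
Variables (K : fieldType) (V : lmodType K) (J : V -> Prop).
Hypothesis subJ : is_submodule J.

Lemma spanned_mod_mem (T : finType) (B : T -> V) t : spanned_mod J B (B t).
Proof.
have [J0 _ _] := subJ; exists (fun s => (s == t)%:R).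
rewrite (bigD1 t) //= eqxx scale1r big1 ?addr0 ?subrr // => s /negPf ->.
by rewrite scale0r.
Qed.

Lemma spanned_mod0 (T : finType) (B : T -> V) v : J v -> spanned_mod J B v.
Proof.
by move=> Jv; exists (fun=> 0); rewrite big1 ?subr0 // => t _; rewrite scale0r.
Qed.

Lemma spanned_modD (T : finType) (B : T -> V) u v :
  spanned_mod J B u -> spanned_mod J B v -> spanned_mod J B (u + v).
Proof.
have [_ JD _] := subJ; case=> w hw [w' hw']; exists (fun t => w t + w' t).
under eq_bigr do rewrite scalerDl.
by rewrite big_split /= opprD addrACA; apply: JD.
Qed.

Lemma spanned_modZ (T : finType) (B : T -> V) c v :
  spanned_mod J B v -> spanned_mod J B (c *: v).
Proof.
have [_ _ JZ] := subJ; case=> w hw; exists (fun t => c * w t).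
under eq_bigr do rewrite -scalerA.
by rewrite -scaler_sumr -scalerBr; apply: JZ.
Qed.

Lemma spanned_mod_sum (T : finType) (B : T -> V) (I : Type) (r : seq I)
    (P : pred I) (F : I -> V) :
  (forall i, P i -> spanned_mod J B (F i)) ->
  spanned_mod J B (\sum_(i <- r | P i) F i).
Proof.
move=> hF; apply: (big_ind (spanned_mod J B)) => //; last exact: spanned_modD.
by apply: spanned_mod0; have [] := subJ.
Qed.

Lemma spanned_mod_linear (T T' : finType) (B : T -> V) (B' : T' -> V)
    (g : {linear V -> V}) v :
    (forall u, J u -> J (g u)) -> (forall t, spanned_mod J B' (g (B t))) ->
  spanned_mod J B v -> spanned_mod J B' (g v).
Proof.
move=> Jg hB [w hw]; rewrite -[v](subrK (\sum_t w t *: B t)) linearD.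
apply: spanned_modD; first by apply: spanned_mod0; apply: Jg.
rewrite linear_sum; apply: spanned_mod_sum => t _.
by rewrite linearZ_LR; apply: spanned_modZ.
Qed.

(** The coefficient matrix has more rows than columns, so it has a nonzero left kernel vector. *)
Lemma spanned_mod_dependent (T T' : finType) (B : T -> V) (g : T' -> V) :
    (#|T| < #|T'|)%N -> (forall t, spanned_mod J B (g t)) ->
  exists2 v : T' -> K, exists t, v t != 0 & J (\sum_t v t *: g t).
Proof.
move=> TT' /choice[w hw]; have [J0 JD JZ] := subJ.
pose A := \matrix_(i < #|T'|, j < #|T|) w (enum_val i) (enum_val j).
have kA : kermx A != 0.
  rewrite kermx_eq0 /row_free neq_ltn.
  by rewrite (leq_ltn_trans (rank_leq_col A)).
have /rowV0Pn[u uA u0] := kA.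
pose v t := u 0 (enum_rank t); exists v.
  have [i ui] := rV0Pn _ u0.
  by exists (enum_val i); rewrite /v enum_valK.
have -> : \sum_t v t *: g t = \sum_t v t *: (g t - \sum_s w t s *: B s).
  under [RHS]eq_bigr do rewrite scalerBr.
  rewrite sumrB [X in _ - X](_ : _ = 0) ?subr0 //.
  under eq_bigr do rewrite scaler_sumr.
  rewrite exchange_big big1 //= => s _.
  under eq_bigr do rewrite scalerA.
  rewrite -scaler_suml.
  move/sub_kermxP: uA => /rowP /(_ (enum_rank s)); rewrite !mxE => h.
  rewrite -[X in X *: _](_ : 0 = _) ?scale0r // -[LHS]h.
  rewrite (reindex _ (onW_bij _ (@enum_rank_bij T'))) /=.
  by apply: eq_bigr => t _; rewrite mxE /v !enum_rankK.
apply: (big_ind J) => // t _; exact/JZ/hw.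
Qed.

End Spanned.

Lemma msizeM_leq n (R : idomainType) (p q : {mpoly R[n]}) k l :
  (msize p <= k)%N -> (msize q <= l.+1)%N -> (msize (p * q) <= k + l)%N.
Proof.
have [->|p0] := eqVneq p 0; first by rewrite mul0r msize0.
have [->|q0] := eqVneq q 0; first by rewrite mulr0 msize0.
by rewrite msizeM // => pk ql; lia.
Qed.

Section Counting.
Variables (K : fieldType) (L : closedFieldType) (iota : {rmorphism K -> L}).
Variable N : nat.
Implicit Types (p q : {mpoly K[N.+1]}) (y : 'rV[L]_N.+1) (Z C : set 'rV[L]_N.+1).

Lemma vanishing_submodule Z : is_submodule (vanishing iota Z).
Proof.
have [v0 vD vM] := vanishing_ideal iota Z; split=> // c p vp.
by rewrite -mul_mpolyC; apply: vM.
Qed.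

(** Exponents are finite functions so that these products can be counted in [chain_meets_forms]. *)
Definition form_monomial d E e (M : 'I_d -> {mpoly K[N.+1]})
    (t : {ffun 'I_d -> 'I_E.+1} * {ffun 'I_N.+1 -> 'I_e}) : {mpoly K[N.+1]} :=
  (\prod_i M i ^+ t.1 i) * \prod_j 'X_j ^+ t.2 j.

(** Modulo the ideal of [Z], an exponent at least [e] is removed by replacing ['X_j ^+ e] with the
    sum of the [M i * G i]. As [G i] has degree below [e], the cofactor of [M i] has smaller degree,
    which pays for the larger exponent of [M i]. *)
Lemma spanned_by_form_monomials Z d e (M : 'I_d -> {mpoly K[N.+1]}) :
    (0 < e)%N ->
    (forall j, exists2 G : 'I_d -> {mpoly K[N.+1]}, forall i, (msize (G i) <= e)%N &
       vanishing iota Z ('X_j ^+ e - \sum_i M i * G i)) ->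
  forall E p, (msize p <= E.+1)%N ->
  spanned_mod (vanishing iota Z) (form_monomial (E := E) (e := e) M) p.
Proof.
move=> e0 hX; have subZ := vanishing_submodule Z.
elim/ltn_ind => E IHE p pE; rewrite (mpolyE p).
rewrite big_seq; apply: spanned_mod_sum => // a /msize_mdeg_lt ap.
apply: spanned_modZ => //.
have aE : (mdeg a <= E)%N by rewrite -ltnS (leq_trans ap).
have [small|] := pselect (forall j, a j < e)%N.
  suff -> : 'X_[a] = form_monomial (E := E) M ([ffun=> ord0], [ffun j => Ordinal (small j)]).
    exact: spanned_mod_mem.
  rewrite /form_monomial /= mpolyXE_id [X in _ = X * _]big1 ?mul1r => [|i _]; last by rewrite ffunE.
  by apply: eq_bigr => j _; rewrite ffunE.
case/existsNP => j /negP; rewrite -leqNgt => ea.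
have [G Gsz hG] := hX j.
have {}ea : (U_(j) *+ e <= a)%MM.
  by apply/mnm_lepP => k; rewrite mulmnE mnm1E; case: eqP => [<-|]; rewrite ?mul1n ?mul0n.
rewrite -(submK ea) mpolyXD -mpolyXn.
set b := (a - _)%MM.
have bE : (mdeg b + e <= E)%N.
  by move: aE; rewrite -{1}(submK ea) mdegD mdegMn mdeg1 mul1n.
have [v0 vD vM] := vanishing_ideal iota Z.
rewrite -['X_j ^+ e](subrK (\sum_i M i * G i)) mulrDr.
apply: spanned_modD => //; first by apply: spanned_mod0; apply: vM.
rewrite mulr_sumr; apply: spanned_mod_sum => // i _.
case: E => [|E] in IHE pE aE bE *; first by lia.
rewrite mulrCA.
have sp : (msize (G i * 'X_[b]) <= E.+1)%N.
  apply: leq_trans (msizeM_leq (Gsz i) (l := mdeg b) _) _; first by rewrite msizeX.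
  by rewrite addnC.
have := IHE E (ltnSn _) _ sp; rewrite ['X_[b] * _]mulrC.
apply: (@spanned_mod_linear _ _ _ subZ _ _ _ _ (M i \*o idfun)) => [u vu|t]; first exact: vM.
suff : M i * form_monomial M t =
  form_monomial M ([ffun k => inord (t.1 k + (k == i))] : {ffun 'I_d -> 'I_E.+2}, t.2).
  by move=> eqM; rewrite /= eqM; apply: spanned_mod_mem.
rewrite /form_monomial /= mulrA; congr (_ * _).
have eqn k : ((inord (t.1 k + (k == i)) : 'I_E.+2) : nat) = (t.1 k + (k == i))%N.
  by rewrite inordK //; case: (t.1 k) => /= c hc; case: eqP; lia.
under [RHS]eq_bigr do rewrite ffunE eqn exprD.
rewrite big_split mulrC; congr (_ * _).
by rewrite (bigD1 i) //= eqxx expr1 big1 ?mulr1 // => k /negPf ->.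
Qed.

Definition homogenize (j : 'I_N.+1) k p : {mpoly K[N.+1]} :=
  \sum_(a <- msupp p) p@_a *: ('X_[a] * 'X_j ^+ (k - mdeg a)).

Lemma msize_homogenize j k p : (msize p <= k.+1)%N ->
  (msize (homogenize j k p) <= k.+1)%N.
Proof.
move=> pk; apply: leq_trans (msize_sum _ _ _) _.
rewrite big_seq; apply/bigmax_leqP_seq => a _ /msize_mdeg_lt ap.
apply: leq_trans (msizeZ_le _ _) _.
by rewrite mpolyXn -mpolyXD msizeX mdegD mdegMn mdeg1 mul1n ltnS; lia.
Qed.

Lemma homogenize_eval j k p y : (msize p <= k)%N ->
  proj_eval iota (homogenize j k p) y =
  if y 0 j == 0 then 0 else y 0 j ^+ k * proj_eval iota p ((y 0 j)^-1 *: y).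
Proof.
move=> pk; rewrite /homogenize proj_eval_sum.
under eq_bigr do rewrite proj_evalZ proj_evalM proj_evalXn proj_evalU.
case: eqP => [->|/eqP y0].
  (* [msize p <= k] means degree below [k], so every completed monomial contains ['X_j]. *)
  rewrite big_seq big1 // => a /msize_mdeg_lt ap.
  by rewrite expr0n (_ : _ == _ = false) ?mulr0 //; apply/eqP; lia.
rewrite [X in proj_eval _ X _](mpolyE p) proj_eval_sum mulr_sumr.
rewrite big_seq [RHS]big_seq; apply: eq_bigr => a /msize_mdeg_lt ap.
rewrite proj_evalZ proj_eval_scale_mon [RHS]mulrCA; congr (_ * _).
rewrite [LHS]mulrC mulrA; congr (_ * _).
have {2}-> : k = (k - mdeg a + mdeg a)%N by lia.
by rewrite exprD exprVn mulfK // expf_neq0.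
Qed.

Hypothesis char0 : [pchar L] =i pred0.

(** By the Nullstellensatz in the chart y_j = 1, the ideal of [Z], the [M i] and ['X_j - 1] generate
    1; homogenizing this identity gives the power of ['X_j]. *)
Lemma coord_power_in_forms Z d (M : 'I_d -> {mpoly K[N.+1]}) :
    zariski_closed iota Z -> (forall i, M i \is 1.-homog) ->
    (forall y, Z y -> ~ forall i, proj_eval iota (M i) y = 0) ->
  exists e0 : nat, forall e, (e0 <= e)%N ->
  forall j, exists2 G : 'I_d -> {mpoly K[N.+1]}, forall i, (msize (G i) <= e)%N &
       vanishing iota Z ('X_j ^+ e - \sum_i M i * G i).
Proof.
move=> cZ M1 noZ.
suff /choice[e0 he0] : forall j, exists e0 : nat, forall e, (e0 <= e)%N ->
  exists2 G : 'I_d -> {mpoly K[N.+1]}, forall i, (msize (G i) <= e)%N &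
       vanishing iota Z ('X_j ^+ e - \sum_i M i * G i).
  exists (\max_j e0 j) => e he j; apply: he0; apply: leq_trans he.
  exact: (leq_bigmax j).
move=> j.
pose I p := exists (g : 'I_d -> {mpoly K[N.+1]}) h,
  vanishing iota Z (p - (\sum_i M i * g i + ('X_j - 1) * h)).
have [v0 vD vM] := vanishing_ideal iota Z.
have idI : is_ideal I.
  split.
  - exists (fun=> 0), 0; rewrite big1 ?mulr0 ?addr0 ?subr0 // => i _.
    by rewrite mulr0.
  - move=> p q [g [h hp]] [g' [h' hq]]; exists (fun i => g i + g' i), (h + h').
    under eq_bigr do rewrite mulrDr.
    rewrite big_split mulrDr /= [X in p + q - X]addrACA opprD addrACA.
    exact: vD.
  move=> p q [g [h hq]]; exists (fun i => p * g i), (p * h).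
  under eq_bigr do rewrite mulrCA.
  rewrite -mulr_sumr mulrCA -mulrDr -mulrBr; exact: vM.
have [[g [h hI]]|nI] := pselect (I 1); last first.
  have [a ha] := weak_nullstellensatz iota (@mpolyC N.+1 K) (fun i => 'X_i) char0 idI nI.
  pose y : 'rV[L]_N.+1 := \row_i a i.
  have evy p : I p -> proj_eval iota p y = 0.
    rewrite -{1}[p]mmap_id => /ha; rewrite proj_evalE /mmap => h0; rewrite -[RHS]h0.
    apply: eq_bigr => b _; congr (_ * _).
    by apply: mmap1_eq => i; rewrite mxE.
  have yj : y 0 j = 1.
    apply/eqP; rewrite -subr_eq0 -(proj_evalU iota) -(proj_eval1 iota y) -proj_evalB.
    apply/eqP/evy; exists (fun=> 0), 1; rewrite big1 => [|i _]; last by rewrite mulr0.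
    by rewrite add0r mulr1 subrr.
  have yM i : proj_eval iota (M i) y = 0.
    apply: evy; exists (fun k => (k == i)%:R), 0.
    rewrite mulr0 addr0 (bigD1 i) //= eqxx mulr1 big1 ?addr0 ?subrr // => k /negPf ->.
    by rewrite mulr0.
  have y0 : y != 0.
    by apply: contra_eq_neq yj => ->; rewrite mxE eq_sym oner_neq0.
  exfalso; apply: (noZ y) yM.
  apply: contrapT => nZ.
  have [k [p [_ vp /eqP py]]] := zariski_closed_witness cZ y0 nZ.
  apply/py/evy; exists (fun=> 0), 0; rewrite big1 => [|i _]; last by rewrite mulr0.
  by rewrite mulr0 addr0 subr0.
(* The form [M i] takes one degree, so [g i] is homogenized in degree k = e - 1. *)
exists (\max_i msize (g i)).+1 => -[//|k]; rewrite ltnS => gk.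
have {}gk i : (msize (g i) <= k)%N by apply: leq_trans gk; apply: (leq_bigmax i).
exists (fun i => homogenize j k (g i)) => [i|y Zy].
  by apply: msize_homogenize; apply: leqW.
rewrite proj_evalB proj_evalXn proj_evalU proj_eval_sum.
under eq_bigr do rewrite proj_evalM homogenize_eval //.
have [->|yj0] := eqVneq (y 0 j) 0.
  by rewrite expr0n big1 ?subr0 // => i _; rewrite mulr0.
have Zy' : Z ((y 0 j)^-1 *: y) by apply: (zariski_closed_scale cZ) Zy; rewrite invr_eq0.
have /eqP := hI _ Zy'.
rewrite proj_evalB proj_evalD proj_evalM proj_evalB proj_evalU !proj_eval1.
rewrite mxE mulVf // subrr mul0r addr0 subr_eq0 => /eqP h1.
apply/eqP; rewrite subr_eq0 -[X in X == _]mulr1 h1 proj_eval_sum mulr_sumr.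
apply/eqP; apply: eq_bigr => i _.
rewrite proj_evalM (proj_eval_homog _ _ _ (M1 i)) expr1 exprS.
move: (proj_eval _ (M i) y) (proj_eval _ (g i) _) => m z.
by rewrite [y 0 j * _]mulrC -!mulrA (mulrA (y 0 j)) divff // mul1r mulrCA.
Qed.

End Counting.

Lemma msize_prodX n (R : idomainType) r (x : 'I_r -> {mpoly R[n]}) (t : 'I_r -> nat) g D :
    (forall k, msize (x k) <= g.+1)%N -> (forall k, t k <= D)%N ->
  (msize (\prod_k x k ^+ t k) <= (r * (D * g)).+1)%N.
Proof.
move=> xg tD.
have pow k l : (msize (x k ^+ l) <= (l * g).+1)%N.
  elim: l => [|l IHl]; first by rewrite expr0 msize1.
  by rewrite exprS mulSn -addSn; apply: msizeM_leq.
have -> : (r * (D * g) = \sum_(k < r) D * g)%N by rewrite sum_nat_const card_ord.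
elim/big_ind2: _ => [|p k q l hp hq|k _]; first by rewrite msize1.
  by rewrite -addSn; apply: msizeM_leq.
by apply: leq_trans (pow _ _) _; rewrite ltnS leq_mul2r tD orbT.
Qed.

Section Chains.
Variables (K : fieldType) (L : closedFieldType) (iota : {rmorphism K -> L}).
Variable N : nat.
Implicit Types (p q : {mpoly K[N.+1]}) (y : 'rV[L]_N.+1) (Z C : set 'rV[L]_N.+1).

Definition irreducible_chain Z l : Prop :=
  exists2 C : 'I_l.+1 -> set 'rV[L]_N.+1,
    (forall k, projective_subvariety iota (C k) /\ C k `<=` Z) &
    (forall k k' : 'I_l.+1, (k < k')%N -> C k `<` C k').

Hypothesis char0 : [pchar L] =i pred0.

Lemma vanishing_origin C p : projective_subvariety iota C -> vanishing iota C p ->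
  proj_eval iota p 0 = 0.
Proof.
move=> [cC [y Cy] _] vp; rewrite -(scale0r y).
rewrite (proj_evalE_pihomog _ _ (leqnn _)) big1 // => d _.
rewrite (proj_eval_homog _ _ _ (pihomogP _ _ _)).
by rewrite (vanishing_pihomog char0 _ cC vp) ?mulr0.
Qed.

(** The affine cone has one more dimension: the ideal of the origin is put below the chain. The
    first function is a coordinate that is not identically zero on [C 0], each next one a form
    vanishing on [C k] but not on [C k.+1]. *)
Lemma chain_tower l (C : nat -> set 'rV[L]_N.+1) :
    (forall k, projective_subvariety iota (C k)) ->
    (forall k, C k `<=` C k.+1) -> (forall k, (k < l)%N -> C k `<` C k.+1) ->
  exists x : 'I_l.+1 -> {mpoly K[N.+1]},
    forall p : {mpoly K[l.+1]}, vanishing iota (C l) (mmap (@mpolyC N.+1 K) x p) -> p = 0.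
Proof.
move=> irrC subC proC.
pose Q k : {mpoly K[N.+1]} -> Prop :=
  vanishing iota (if k is k'.+1 then C k' else [set 0]).
suff /choice[x hx] : forall k : 'I_l.+1, exists x, Q k x /\
    forall a, Q k.+1 (a * x) -> Q k.+1 a.
  exists x; apply: (@tower_independent _ _ _ _ Q).
  - by move=> k; apply: vanishing_ideal.
  - by move=> /(_ 0 erefl) /eqP; rewrite proj_eval1 oner_eq0.
  - case=> [|k] a; last by move=> h y /subC /h.
    by move=> /(vanishing_origin (irrC 0)) h y ->.
  - by move=> k; have [] := hx k.
  - by move=> k; have [] := hx k.
case=> -[|k] kl.
  have [cC [y Cy] _] := irrC 0.
  have /rV0Pn[j yj] := zariski_closed_neq0 cC Cy.
  exists 'X_j; split=> [z ->|a]; first by rewrite proj_evalU mxE.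
  rewrite mulrC; apply: (vanishing_cancel char0 (irrC 0)) (_ : _ \is 1.-homog) _.
    by rewrite dhomogX /= mdeg1.
  by move=> /(_ y Cy) /eqP; rewrite proj_evalU (negPf yj).
have [sub nsub] := proC k kl; have [cC _ _] := irrC k; have [cC' _ _] := irrC k.+1.
have [y Cy nCy] : exists2 y, C k.+1 y & ~ C k y.
  by apply: contrapT => no; apply: nsub => y Cy; apply: contrapT => nCy; apply: no; exists y.
have [d [p [pd vp py]]] := zariski_closed_witness cC (zariski_closed_neq0 cC' Cy) nCy.
exists p; split=> [//|a]; rewrite mulrC.
apply: (vanishing_cancel char0 (irrC k.+1)) pd _.
by move=> /(_ y Cy) /eqP; rewrite (negPf py).
Qed.

(** Without a common zero, the functions on the top of the chain would be a finite module over
    polynomials in [d] forms; by counting dimensions this leaves no room for the [d.+1] independent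
    functions of [chain_tower]. *)
Lemma chain_meets_forms Z d (M : 'I_d -> {mpoly K[N.+1]}) :
    irreducible_chain Z d -> (forall i, M i \is 1.-homog) ->
  exists2 y, Z y & forall i, proj_eval iota (M i) y = 0.
Proof.
case=> C0 hC0 proC0 M1.
pose C k := C0 (inord (minn k d)).
have irrC k : projective_subvariety iota (C k) by have [] := hC0 (inord (minn k d)).
have proC k : (k < d)%N -> C k `<` C k.+1.
  by move=> kd; apply: proC0; rewrite !inordK ?ltnS ?geq_minr //; lia.
have subC k : C k `<=` C k.+1.
  case: (ltnP k d) => [/proC[] //|dk].
  by rewrite /C (_ : minn k d = minn k.+1 d) //; lia.
have [x hx] := chain_tower irrC subC proC.
apply: contrapT => no; have [cC _ _] := irrC d.
have noC y : C d y -> ~ forall i, proj_eval iota (M i) y = 0.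
  by move=> Cy My; apply: no; exists y => //; have [_] := hC0 (inord (minn d d)); apply.
have [e0 he0] := coord_power_in_forms char0 cC M1 noC.
have span := spanned_by_form_monomials (ltn0Sn e0) (he0 _ (leqnSn e0)).
pose g := \max_k msize (x k).
(* There are (c+1)^(d+1) products of the [x k] with exponents at most c, and (E+1)^d * (e0+1)^(N+1)
   spanning elements; as E + 1 <= (c+1) ((d+1) g + 1), the latter number is at most (c+1)^d c. *)
pose c := ((d.+1 * g).+1 ^ d * e0.+1 ^ N.+1)%N.
pose E := (d.+1 * (c.+1 * g))%N.
pose mon (t : {ffun 'I_d.+1 -> 'I_c.+1}) := [multinom (t k : nat) | k < d.+1].
have [|t|v [t0 vt0] vv] := spanned_mod_dependent (vanishing_submodule iota (C d))
  (B := form_monomial (E := E) (e := e0.+1) M) (g := fun t => mmap1 x (mon t)).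
- rewrite card_prod !card_ffun !card_ord.
  have EE : (E.+1 <= c.+1 * (d.+1 * g).+1)%N.
    by rewrite /E mulnCA mulnS addnC -addn1 leq_add2l.
  apply: leq_ltn_trans (_ : (c.+1 ^ d * c) < _)%N; last first.
    by rewrite expnSr ltn_pmul2l // expn_gt0.
  rewrite {2}/c mulnA leq_mul2r -expnMn; apply/orP; right.
  by have [->|d0] := posnP d; rewrite ?expn0 // leq_exp2r.
- apply: span; apply: msize_prodX => k; last by rewrite mnmE -ltnS ltnW // ltnS ltn_ord.
  by apply: leqW; apply: (leq_bigmax k).
pose p := \sum_t v t *: 'X_[mon t] : {mpoly K[d.+1]}.
have p0 : p = 0.
  apply: hx; rewrite /p rmorph_sum /=.
  have -> // : \sum_t mmap (@mpolyC N.+1 K) x (v t *: 'X_[mon t]) =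
    \sum_t v t *: mmap1 x (mon t).
  by apply: eq_bigr => t _; rewrite mmapZ mmapX mul_mpolyC.
have := congr1 (fun q : {mpoly K[d.+1]} => q@_(mon t0)) p0; rewrite /p raddf_sum mcoeff0 /=.
rewrite (bigD1 t0) //= mcoeffZ mcoeffX eqxx mulr1 big1 ?addr0 => [|t tt0].
  by move/eqP; rewrite (negPf vt0).
rewrite mcoeffZ mcoeffX; case: eqP => [/mnmP h|]; last by rewrite mulr0.
case/eqP: tt0; apply/ffunP => k; apply: val_inj.
by have := h k; rewrite !mnmE.
Qed.

End Chains.

(** * Noetherianity and cutting by linear forms *)

Lemma wf_minimal (T : Type) (R : T -> T -> Prop) (U : Type) (f : U -> T)
    (P : U -> Prop) : well_founded R -> (exists u, P u) ->
  exists2 u, P u & forall v, P v -> ~ R (f v) (f u).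
Proof.
move=> wfR [u Pu]; move ut : (f u) => t; move: u Pu ut.
elim/(well_founded_ind wfR): t => t IHt u Pu ut.
have [[v [Pv vt]]|no] := pselect (exists v, P v /\ R (f v) t).
  exact: IHt vt _ Pv erefl.
by exists u => // v Pv vu; apply: no; exists v; rewrite -ut.
Qed.

Lemma nondecreasing_subsequence (u : nat -> nat) :
  exists2 phi : nat -> nat, forall k, (phi k < phi k.+1)%N &
    forall k, (u (phi k) <= u (phi k.+1))%N.
Proof.
have /choice[m hm] s : exists j, (s <= j)%N /\ forall j', (s <= j')%N -> (u j <= u j')%N.
  suff : forall v j, (s <= j)%N -> (u j <= v)%N -> exists j, (s <= j)%N /\
      forall j', (s <= j')%N -> (u j <= u j')%N.
    by move=> /(_ (u s) s); apply.
  elim=> [|v IHv] j sj uj; first by exists j; split => // j' _; lia.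
  have [[j' [sj' uj']]|no] := pselect (exists j', (s <= j')%N /\ (u j' <= v)%N).
    exact: IHv uj'.
  exists j; split => // j' sj'; rewrite leqNgt; apply/negP => lt; apply: no.
  by exists j'; split => //; lia.
pose phi := fix phi k := if k is k'.+1 then m (phi k').+1 else m 0.
have phiS k : (phi k < phi k.+1)%N by case: (hm (phi k).+1).
exists phi => // k; suff [s sk ->] : exists2 s, (s <= phi k)%N & phi k = m s.
  by have [_] := hm s; apply; apply: leq_trans sk (ltnW (phiS k)).
by case: k => [|k]; [exists 0 | exists (phi k).+1].
Qed.

Lemma increasing_leq (phi : nat -> nat) : (forall k, phi k < phi k.+1)%N ->
  {homo phi : j k / (j < k)%N}.
Proof. by move=> h; apply: homo_ltn ltn_trans h. Qed.

(** Successive subsequences make one more exponent nondecreasing each time. *)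
Lemma dickson n (a : nat -> 'X_{1..n}) :
  exists i j, (i < j)%N /\ (a i <= a j)%MM.
Proof.
suff /(_ n)[phi phiS ha] : forall t, exists2 phi : nat -> nat,
    forall k, (phi k < phi k.+1)%N &
    forall (i : 'I_n) k, (i < t)%N -> (a (phi k) i <= a (phi k.+1) i)%N.
  by exists (phi 0), (phi 1); split => //; apply/mnm_lepP => i; apply: ha.
elim=> [|t [phi phiS ha]]; first by exists id.
have [tn|nt] := ltnP t n; last first.
  exists phi => // i k _; apply: ha; exact: leq_trans (ltn_ord i) nt.
have [psi psiS hpsi] := nondecreasing_subsequence (fun k => a (phi k) (Ordinal tn)).
exists (phi \o psi) => [k|i k]; first exact: (increasing_leq phiS (psiS k)).
rewrite ltnS leq_eqVlt => /orP[/eqP it|it].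
  have -> : i = Ordinal tn by apply: val_inj.
  exact: hpsi.
have := ltnW (psiS k); rewrite /=.
elim: (psi k.+1) => [|l IHl]; first by rewrite leqn0 => /eqP ->.
rewrite leq_eqVlt => /orP[/eqP <- //|/IHl h].
by apply: leq_trans h _; apply: ha.
Qed.

Section Noetherian.
Variables (K : fieldType) (L : closedFieldType) (iota : {rmorphism K -> L}).
Variable N : nat.
Implicit Types (p q : {mpoly K[N.+1]}) (y : 'rV[L]_N.+1) (Z C : set 'rV[L]_N.+1).

(** Among the polynomials vanishing on [Z k.+1] but not on [Z k], take [p k] with least leading
    monomial. By [dickson] some leading monomial divides a later one, and subtracting a multiple of
    the earlier polynomial lowers it. *)
Lemma zariski_dcc (Z : nat -> set 'rV[L]_N.+1) :
  (forall k, zariski_closed iota (Z k)) -> ~ forall k, Z k.+1 `<` Z k.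
Proof.
move=> cZ proZ.
have subZ i j : (i <= j)%N -> Z j `<=` Z i.
  elim: j => [|j IHj]; first by rewrite leqn0 => /eqP ->.
  rewrite leq_eqVlt => /orP[/eqP-> //|/IHj h]; apply: subset_trans h.
  by have [] := proZ j.
have /choice[p hp] k : exists p, (vanishing iota (Z k.+1) p /\ ~ vanishing iota (Z k) p) /\
    forall q, vanishing iota (Z k.+1) q /\ ~ vanishing iota (Z k) q ->
    ~ (mlead q < mlead p)%O.
  suff ex : exists p, vanishing iota (Z k.+1) p /\ ~ vanishing iota (Z k) p.
    by have [p hp hq] := wf_minimal (@mlead N.+1 K) (@ltom_wf N.+1) ex; exists p.
  have [_ nsub] := proZ k.
  have [y Zy nZy] : exists2 y, Z k y & ~ Z k.+1 y.
    by apply: contrapT => no; apply: nsub => y Zy; apply: contrapT => nZy; apply: no; exists y.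
  have [d [p [_ vp /eqP py]]] :=
    zariski_closed_witness (cZ k.+1) (zariski_closed_neq0 (cZ k) Zy) nZy.
  by exists p; split => // /(_ y Zy).
have [i [j [ij aij]]] := dickson (fun k => mlead (p k)).
have [[vpi nvpi] _] := hp i; have [[vpj nvpj] minj] := hp j.
have neq0 k q : ~ vanishing iota (Z k) q -> q != 0.
  by move=> nv; apply/eqP => q0; apply: nv; rewrite q0; case: (vanishing_ideal iota (Z k)).
have pi0 := neq0 _ _ nvpi; have pj0 := neq0 _ _ nvpj.
pose c := mleadc (p j) / mleadc (p i).
have c0 : c != 0 by rewrite mulf_neq0 ?invr_eq0 ?mleadc_eq0.
pose r := c *: 'X_[mlead (p j) - mlead (p i)] * p i.
have X0 m : 'X_[m] != 0 :> {mpoly K[N.+1]} by rewrite -msize_poly_eq0 msizeX.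
have r0 : r != 0 by rewrite mulf_neq0 // scaler_eq0 negb_or c0 X0.
have lr : mlead r = mlead (p j).
  by rewrite mleadM ?scaler_eq0 ?negb_or ?c0 ?X0 // mleadZ // mleadXm submK.
have vr : vanishing iota (Z j) r.
  move=> y Zy; rewrite proj_evalM vpi ?mulr0 //; exact: subZ Zy.
have [v0 vD vM] := vanishing_ideal iota (Z j).
have hq : vanishing iota (Z j.+1) (p j - r) /\ ~ vanishing iota (Z j) (p j - r).
  split=> [y Zy|vq]; first by rewrite proj_evalB vpj // vr ?subrr //; apply: subZ Zy.
  by apply: nvpj; rewrite -(subrK r (p j)); apply: vD.
(* [p j - r] contradicts the minimality of the leading monomial of [p j]. *)
apply: (minj _ hq).
rewrite lt_neqAle; apply/andP; split; last first.
  by apply: le_trans (mleadB_le _ _) _; rewrite lr joinxx.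
apply/eqP => lq; case: hq => _ /neq0; rewrite -mleadc_eq0 lq mcoeffB.
have -> : r@_(mlead (p j)) = mleadc (p j).
  by rewrite -{1}(submK aij) /r -scalerAl mcoeffZ ['X_[_] * _]mulrC mcoeffMX divfK ?mleadc_eq0.
by rewrite subrr eqxx.
Qed.

Lemma noetherian_ind (P : set 'rV[L]_N.+1 -> Prop) :
    (forall Z, zariski_closed iota Z ->
      (forall Z', zariski_closed iota Z' -> Z' `<` Z -> P Z') -> P Z) ->
  forall Z, zariski_closed iota Z -> P Z.
Proof.
move=> IH Z0 cZ0; apply: contrapT => nP0.
pose bad := {Z | zariski_closed iota Z /\ ~ P Z}.
have /choice[next hnext] : forall Z : bad, exists Z' : bad, sval Z' `<` sval Z.
  move=> [Z [cZ nP]] /=; apply: contrapT => no; apply: nP; apply: IH => // Z' cZ' ZZ'.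
  by apply: contrapT => nP'; apply: no; exists (exist _ Z' (conj cZ' nP')).
pose Z k := sval (iter k next (exist _ Z0 (conj cZ0 nP0))).
apply: (@zariski_dcc Z) => k; last exact: hnext.
by rewrite /Z; case: (iter _ _ _) => Z' [].
Qed.
End Noetherian.

Section Cutting.
Variables (K : fieldType) (L : closedFieldType) (iota : {rmorphism K -> L}).
Variable N : nat.
Implicit Types (p q : {mpoly K[N.+1]}) (y : 'rV[L]_N.+1) (Z C W : set 'rV[L]_N.+1).
Local Notation chain := (irreducible_chain iota).

Lemma irreducible_chainS Z W l : Z `<=` W -> chain Z l -> chain W l.
Proof.
move=> ZW [C hC pC]; exists C => // k; have [iC CZ] := hC k.
by split=> //; apply: subset_trans ZW.
Qed.

Lemma irreducible_chain_top Z l : chain Z l ->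
  exists C, [/\ projective_subvariety iota C, C `<=` Z & chain C l].
Proof.
case=> C hC pC; have [iC CZ] := hC ord_max.
exists (C ord_max); split=> //; exists C => // k; split; first by have [] := hC k.
have : (k <= l)%N by rewrite -ltnS.
rewrite leq_eqVlt => /orP[/eqP kl|kl]; first by have -> : k = ord_max by apply: val_inj.
by have [] := pC k ord_max kl.
Qed.

Lemma irreducible_chain_extend Z W l : projective_subvariety iota Z -> W `<` Z ->
  chain W l -> chain Z l.+1.
Proof.
move=> irrZ [WZ nZW] [C hC pC].
exists (fun k : 'I_l.+2 => oapp C Z (unlift ord_max k)) => [k|k k' kk'].
  case: unliftP => [j _|_] /=; last by split.
  by have [iC CW] := hC j; split=> // y /CW /WZ.
have [j|] := unliftP ord_max k => kE; last first.
  by move: kk'; rewrite kE /= ltnNge -ltnS ltn_ord.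
have [j'|] := unliftP ord_max k'.
  by move=> k'E /=; apply: pC; move: kk'; rewrite kE k'E !lift_max.
have [_ CW] := hC j => _ /=.
by split=> [y /CW /WZ //|ZC]; apply: nZW => y /ZC /CW.
Qed.

Lemma irreducible_chain_drop Z l : chain Z l.+1 -> chain Z l.
Proof.
case=> C hC pC; exists (C \o widen_ord (leqnSn _)) => [k|k k' kk'] /=; first exact: hC.
exact: pC.
Qed.

Lemma irreducible_chain_leq Z k l : (k <= l)%N -> chain Z l -> chain Z k.
Proof.
elim: l => [|l IHl]; first by rewrite leqn0 => /eqP ->.
rewrite leq_eqVlt => /orP[/eqP -> //|/IHl h] /irreducible_chain_drop; exact: h.
Qed.

(** The coordinates of [y] lie in [L], so its closure over [K] may exceed the line of [y]. It is
    irreducible because every closed set containing [y] contains it. *)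
Lemma point_closure y : y != 0 ->
  projective_subvariety iota
    [set z | z != 0 /\ forall d p, p \is d.-homog -> proj_eval iota p y = 0 ->
       proj_eval iota p z = 0].
Proof.
move=> y0; split.
- exists [set p | (exists d, p \is d.-homog) /\ proj_eval iota p y = 0].
    by move=> p [].
  apply/seteqP; split=> z [z0 hz]; split=> //.
    by move=> p [[d pd] py]; exact: (hz d p pd py).
  by move=> d p pd py; exact: (hz p (conj (ex_intro _ d pd) py)).
- by exists y.
move=> A B cA cB sub; have : (A `|` B) y by apply: sub.
have cl Z : zariski_closed iota Z -> Z y -> [set z | z != 0 /\ forall d p,
    p \is d.-homog -> proj_eval iota p y = 0 -> proj_eval iota p z = 0] `<=` Z.
  move=> cZ Zy z [z0 hz]; apply: contrapT => nZz.
  have [d [p [pd vp /eqP pz]]] := zariski_closed_witness cZ z0 nZz.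
  exact/pz/(hz d)/vp.
by case=> h; [left | right]; apply: cl.
Qed.

Lemma irreducible_chain0 Z y : zariski_closed iota Z -> Z y -> chain Z 0.
Proof.
move=> cZ Zy.
exists (fun=> [set z | z != 0 /\ forall d p, p \is d.-homog ->
    proj_eval iota p y = 0 -> proj_eval iota p z = 0]) => [_|k k']; last first.
  by rewrite !ord1.
split; first by apply: point_closure; exact: zariski_closed_neq0 cZ Zy.
move=> z [z0 hz]; apply: contrapT => nZz.
have [d [p [pd vp /eqP pz]]] := zariski_closed_witness cZ z0 nZz.
exact/pz/(hz d)/vp.
Qed.

(** Stands in for the decomposition into components: a component inside [B] already has dimension
    below [s], and on any other one a single point outside [B] and [H] shows that [H] cuts it
    properly. *)
Lemma cut_witness B s : zariski_closed iota B ->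
  forall Z, zariski_closed iota Z -> ~ chain (Z `&` B) s -> ~ chain Z s.+1 ->
  exists2 pts : seq 'rV[L]_N.+1, forall y, y \in pts -> Z y /\ ~ B y &
    forall H, (forall y, y \in pts -> ~ H y) -> ~ chain (Z `&` H) s.
Proof.
move=> cB; apply: noetherian_ind => Z cZ IHZ nZB nZ.
have [|nirr] := pselect (projective_subvariety iota Z).
  move=> irrZ; have [ZB|nZsB] := pselect (Z `<=` B).
    exists [::] => // H _ cH; apply: nZB; apply: irreducible_chainS cH => y [Zy _].
    by split=> //; apply: ZB.
  have [y Zy nBy] : exists2 y, Z y & ~ B y.
    by apply: contrapT => no; apply: nZsB => y Zy; apply: contrapT => nBy; apply: no; exists y.
  exists [:: y] => [z|H hH cH]; first by rewrite inE => /eqP ->.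
  apply: nZ; apply: irreducible_chain_extend cH => //; split=> [z []//|sub].
  by have [_] := sub y Zy; apply: hH; rewrite inE.
have [Z0|/contrapT[y Zy]] := pselect (~ (Z !=set0)).
  exists [::] => // H _ [C hC _]; have [[_ [y Cy] _] sub] := hC ord0.
  by apply: Z0; exists y; have [] := sub y Cy.
have /existsNP[A /existsNP[A' h]] : ~ forall A A', zariski_closed iota A ->
    zariski_closed iota A' -> Z `<=` A `|` A' -> Z `<=` A \/ Z `<=` A'.
  by move=> h; apply: nirr; split=> //; exists y.
move: h => /not_implyP[cA /not_implyP[cA' /not_implyP[ZAA' /not_orP[nA nA']]]].
have part A0 : zariski_closed iota A0 -> ~ Z `<=` A0 ->
    exists2 pts : seq 'rV[L]_N.+1, forall y, y \in pts -> Z y /\ ~ B y &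
    forall H, (forall y, y \in pts -> ~ H y) -> ~ chain ((Z `&` A0) `&` H) s.
  move=> cA0 nA0; case: (IHZ (Z `&` A0)).
  - exact: zariski_closedI.
  - by split=> [z []//|sub]; apply: nA0 => z /sub [].
  - by move=> h; apply: nZB; apply: irreducible_chainS h => z [[]].
  - by move=> h; apply: nZ; apply: irreducible_chainS h => z [].
  by move=> pts hp hH; exists pts => // z /hp [[]].
have [pts hpts hH] := part _ cA nA; have [pts' hpts' hH'] := part _ cA' nA'.
exists (pts ++ pts') => [z|H hyp cH].
  by rewrite mem_cat => /orP[/hpts|/hpts'].
(* The top of a chain is irreducible, so the whole chain lies in one of the two pieces. *)
have [C [irrC CZH cC]] := irreducible_chain_top cH; have [_ _ irr] := irrC.
have [CA|CA'] := irr A A' cA cA' (fun z Cz => ZAA' z (CZH z Cz).1).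
- apply: (hH H) => [z zp|]; first by apply: hyp; rewrite mem_cat zp.
  by apply: irreducible_chainS cC => z Cz; have [Zz Hz] := CZH z Cz; split=> //; split=> //; apply: CA.
- apply: (hH' H) => [z zp|]; first by apply: hyp; rewrite mem_cat zp orbT.
  by apply: irreducible_chainS cC => z Cz; have [Zz Hz] := CZH z Cz; split=> //; split=> //; apply: CA'.
Qed.

Definition linear_form (u : 'I_N.+1 -> K) : {mpoly K[N.+1]} := \sum_j u j *: 'X_j.

Lemma linear_form_homog u : linear_form u \is 1.-homog.
Proof.
by apply: rpred_sum => j _; apply: rpredZ; rewrite dhomogX /= mdeg1.
Qed.

Lemma linear_form_eval u y :
  proj_eval iota (linear_form u) y = \sum_j iota (u j) * y 0 j.
Proof.
by rewrite proj_eval_sum; apply: eq_bigr => j _; rewrite proj_evalZ proj_evalU.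
Qed.

Definition coordinate_subspace (B : {set 'I_N.+1}) : set 'rV[L]_N.+1 :=
  [set y : 'rV[L]_N.+1 | y != 0 /\ forall j, j \in B -> y 0 j = 0].

Lemma coordinate_subspace_closed B : zariski_closed iota (coordinate_subspace B).
Proof.
exists [set 'X_j | j in [set j | j \in B]].
  by move=> _ [j _ <-]; exists 1%N; rewrite dhomogX /= mdeg1.
apply/seteqP; split=> y [y0 hy]; split=> //.
  by move=> _ [j jB <-]; rewrite proj_evalU; apply: hy.
by move=> j jB; rewrite -(proj_evalU iota); apply: hy; exists j.
Qed.

Hypothesis char0 : [pchar L] =i pred0.

(** Each form is chosen to avoid the finitely many points of [cut_witness], so that the dimension
    drops at every step; after [s] steps nothing remains. *)
Lemma cut_by_forms s Z (B : 'I_s -> {set 'I_N.+1}) : zariski_closed iota Z ->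
    ~ chain Z s ->
    (forall k : 'I_s, ~ chain (Z `&` coordinate_subspace (B k)) (s - k.+1)) ->
  exists2 u : 'I_s -> 'I_N.+1 -> K, (forall k j, j \notin B k -> u k j = 0) &
    forall y, Z y -> ~ forall k, proj_eval iota (linear_form (u k)) y = 0.
Proof.
elim: s Z B => [|s IHs] Z B cZ nZ nB.
  by exists (fun _ _ => 0) => // y Zy _; apply: nZ; apply: irreducible_chain0 Zy.
have := nB ord0; rewrite subn1 /= => nB0.
have [pts hpts hH] := cut_witness (coordinate_subspace_closed (B ord0)) cZ nB0 nZ.
pose P p := exists2 u : 'I_N.+1 -> K, forall j, j \notin B ord0 -> u j = 0 &
  p = linear_form u.
have [||y /hpts[Zy nBy]|p [u0 hu0 ->] hpt] := @simultaneous_nonvanishing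
  {mpoly K[N.+1]} L _ (fun y : 'rV[L]_N.+1 => mmap iota (y 0)) P pts char0.
- exists (fun=> 0) => //.
  by rewrite /linear_form big1 // => j _; rewrite scale0r.
- move=> _ _ [u hu ->] [v hv ->]; exists (fun j => u j + v j).
    by move=> j jB; rewrite hu // hv // addr0.
  by rewrite /linear_form -big_split; apply: eq_bigr => j _; rewrite scalerDl.
(* Off the coordinate subspace, some coordinate indexed by [B ord0] is itself an admissible form
   that is nonzero at [y]. *)
- have [j jB yj] : exists2 j, j \in B ord0 & y 0 j != 0.
    apply: contrapT => no; apply: nBy; split; first exact: zariski_closed_neq0 cZ Zy.
    by move=> j jB; apply/eqP; apply: contrapT => /negP yj; apply: no; exists j.
  have ev : proj_eval iota (linear_form (fun k => (k == j)%:R)) y = y 0 j.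
    rewrite linear_form_eval (bigD1 j) //= eqxx rmorph1 mul1r big1 ?addr0 //.
    by move=> k /negPf ->; rewrite rmorph0 mul0r.
  exists (linear_form (fun k => (k == j)%:R)); last by move: yj; rewrite -ev proj_evalE.
  by exists (fun k => (k == j)%:R) => // k; case: eqP => // ->; rewrite jB.
pose H := [set y | y != 0 /\ proj_eval iota (linear_form u0) y = 0].
have cH : zariski_closed iota H := zariski_closed_zero iota (linear_form_homog u0).
have nZH : ~ chain (Z `&` H) s.
  by apply: hH => y /hpt /eqP yn [_]; rewrite proj_evalE.
have [k|u hu hy] := IHs (Z `&` H) (B \o lift ord0) (zariski_closedI cZ cH) nZH.
  move=> h; apply: (nB (lift ord0 k)); rewrite lift0 subSS.
  by apply: irreducible_chainS h => y [[Zy _] By].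
exists (fun k => oapp u u0 (unlift ord0 k)).
  by move=> k j; case: unliftP => [k'|] -> /=; [apply: hu | apply: hu0].
move=> y Zy h; apply: (hy y).
  split=> //; split; first exact: zariski_closed_neq0 cZ Zy.
  by have := h ord0; rewrite unlift_none.
by move=> k; have := h (lift ord0 k); rewrite liftK.
Qed.

End Cutting.

(** * Summation *)

Lemma abel_sum_ge0 (R : realDomainType) (c d : nat -> R) m :
    (forall j, (j < m)%N -> 0 <= c j) ->
    (forall j, (j.+1 < m)%N -> c j.+1 <= c j) ->
    (forall k, (k <= m)%N -> 0 <= \sum_(j < k) d j) ->
  0 <= \sum_(j < m) d j * c j.
Proof.
move=> c0 cS D0.
suff h k : (k < m)%N -> c k * \sum_(j < k.+1) d j <= \sum_(j < k.+1) d j * c j.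
  case: m => [|m] in c0 cS D0 h *; first by rewrite big_ord0.
  by apply: le_trans (h m (ltnSn m)); rewrite mulr_ge0 ?c0 ?D0.
elim: k => [|k IHk] km; first by rewrite !big_ord1 mulrC.
rewrite big_ord_recr [leRHS]big_ord_recr /= mulrDr [c _ * d _]mulrC lerD2r.
apply: le_trans (IHk (ltnW km)).
by apply: ler_wpM2r; [apply: D0; apply: ltnW | apply: cS].
Qed.

(** By Abel summation it suffices that at least lam * k of the [t s] are below k. If s is the first
    index with k <= t s, then s of them are, and lam * k <= lam * delta * s <= s; if there is none,
    all n + 1 are, and lam * (m + 1) <= n + 1. *)
Lemma weighted_selection_small (R : realFieldType) (n m : nat) (c : nat -> R)
    (t : 'I_n.+1 -> nat) (delta : R) :
    (forall j, (j < m.+1)%N -> 0 <= c j) ->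
    (forall j, (j.+1 < m.+1)%N -> c j.+1 <= c j) ->
    (forall s, t s <= m)%N -> 1 <= delta -> n%:R + delta <= m.+1%:R ->
    (forall s : 'I_n.+1, (t s)%:R <= delta * s%:R) ->
  (n%:R + delta) / (m.+1%:R * delta) * \sum_(j < m.+1) c j <= \sum_s c (t s).
Proof.
move=> c0 cS tm d1 nd td.
set lam := _ / _; have d0 : 0 < delta by lra.
have m0 : 0 < m.+1%:R :> R by rewrite ltr0n.
have n0 : 0 <= n%:R :> R by rewrite ler0n.
have lam0 : 0 <= lam by rewrite divr_ge0 ?mulr_ge0 //; lra.
have lamd : lam * delta <= 1.
  have -> : lam * delta = (n%:R + delta) / m.+1%:R.
    by rewrite /lam invfM mulrA mulfVK // gt_eqF.
  by rewrite ler_pdivrMr // mul1r.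
have lamm : lam * m.+1%:R <= n.+1%:R.
  have -> : lam * m.+1%:R = (n%:R + delta) / delta.
    by rewrite /lam invfM [_^-1 * _]mulrC mulrA mulfVK // gt_eqF.
  by rewrite ler_pdivrMr // -natr1; nra.
have -> : \sum_s c (t s) = \sum_(j < m.+1) (\sum_s (t s == j)%:R) * c j.
  under [RHS]eq_bigr do rewrite mulr_suml.
  rewrite exchange_big; apply: eq_bigr => s _.
  have ts : (t s < m.+1)%N by rewrite ltnS.
  rewrite (bigD1 (Ordinal ts)) //= eqxx mul1r big1 ?addr0 // => j jt.
  by rewrite eq_sym (_ : _ == _ = false) ?mul0r //; apply/negbTE.
rewrite mulr_sumr -subr_ge0 -sumrB.
under eq_bigr do rewrite -mulrBl.
apply: (@abel_sum_ge0 _ c (fun j => \sum_s (t s == j)%:R - lam)) => // k km.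
rewrite sumrB exchange_big sumr_const card_ord subr_ge0 -mulr_natr.
have -> : \sum_(s < n.+1) \sum_(j < k) (t s == j)%:R = \sum_(s < n.+1) (t s < k)%:R :> R.
  apply: eq_bigr => s _; have [tk|kt] := ltnP (t s) k.
    rewrite (bigD1 (Ordinal tk)) //= eqxx big1 ?addr0 // => j jt.
    by rewrite eq_sym (_ : _ == _ = false) //; apply/negbTE.
  by rewrite big1 // => j _; case: eqP => // tj; move: kt; rewrite tj leqNgt ltn_ord.
case: (pickP (fun s => k <= t s)%N) => [s0 ks0|no].
  case: (@arg_minnP _ s0 (fun s => k <= t s)%N val ks0) => s ks smin.
  apply: (@le_trans _ _ s%:R).
    have kts : k%:R <= delta * s%:R by apply: le_trans (td s); rewrite ler_nat.
    by have s0' : 0 <= s%:R :> R := ler0n _ _; nra.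
  have -> : s%:R = \sum_(s' < n.+1 | (s' < s)%N) 1 :> R.
    have := @big_ord_widen R 0 +%R s n.+1 (fun=> 1) (ltnW (ltn_ord s)).
    by rewrite (sumr_const 'I_s) card_ord.
  rewrite big_mkcond; apply: ler_sum => s' _; case: ifP => [lt|_]; last exact: ler0n.
  rewrite (_ : (t s' < k)%N) // ltnNge; apply/negP => /smin /=.
  by rewrite leqNgt lt.
apply: (@le_trans _ _ n.+1%:R).
  by apply: le_trans lamm; rewrite ler_wpM2l // ler_nat.
rewrite (eq_bigr (fun=> 1)) => [|s _]; last by rewrite ltnNge no.
by rewrite sumr_const card_ord.
Qed.

Lemma weighted_selection (R : realFieldType) (n m : nat) (c : nat -> R)
    (t : 'I_n.+1 -> nat) (delta : R) :
    (forall j, (j < m.+1)%N -> 0 <= c j) ->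
    (forall j, (j.+1 < m.+1)%N -> c j.+1 <= c j) -> (n <= m)%N ->
    (forall s, t s <= m)%N -> (forall s : 'I_n.+1, t s + n <= m + s)%N ->
    1 <= delta -> (forall s : 'I_n.+1, (t s)%:R <= delta * s%:R) ->
  (n%:R + delta) / (m.+1%:R * delta) * \sum_(j < m.+1) c j <= \sum_s c (t s).
Proof.
move=> c0 cS nm tm tnm d1 td.
have [nd|nd] := lerP (n%:R + delta) m.+1%:R; first exact: weighted_selection_small.
(* The bound decreases with [delta], and [t] satisfies [t s <= (m + 1 - n) s]. *)
pose delta' : R := (m.+1 - n)%:R.
have d'E : n%:R + delta' = m.+1%:R by rewrite -natrD subnKC // ltnW.
have d'1 : 1 <= delta' by rewrite ler1n subn_gt0.
apply: (@le_trans _ _ ((n%:R + delta') / (m.+1%:R * delta') * \sum_(j < m.+1) c j)).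
  apply: ler_wpM2r.
    by apply: sumr_ge0 => j _; apply: c0.
  have m0 : 0 < m.+1%:R :> R by rewrite ltr0n.
  have n0 : 0 <= n%:R :> R by rewrite ler0n.
  have dd : delta' < delta by lra.
  have h : 0 <= m.+1%:R * n%:R * (delta - delta') 
    by apply: mulr_ge0; [apply: mulr_ge0 => //; exact: ltW | lra].
  rewrite ler_pdivrMr ?mulr_gt0 //; last by lra.
  rewrite mulrAC ler_pdivlMr ?mulr_gt0 //; last by lra.
  by rewrite -subr_ge0; apply: le_trans h _; rewrite le_eqVlt; apply/orP; left; apply/eqP; ring.
apply: weighted_selection_small => //; first by rewrite d'E.
move=> s; rewrite -natrM ler_nat; have := tnm s.
(* For s = 0 the bound by [delta * s] forces t s = 0; for s >= 1, t s <= (m - n) + s <= (m + 1 - n)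
   s. *)
have [s0|s0] := posnP s.
  by have := td s; rewrite s0 mulr0 -[0]/(0%:R) ler_nat; lia.
by nia.
Qed.

(** * Chow weight and distributive constant *)

Section ChowWeight.
Variables (K : fieldType) (N n : nat) (RR : realType) (c : 'I_N.+1 -> RR).
Hypothesis c_ge0 : forall j, 0 <= c j.
Implicit Types F : {mpoly K[n.+1 * N.+1]}.

Lemma t_exponent_ge0 (x : 'X_{1..n.+1 * N.+1}) : 0 <= t_exponent c x.
Proof. by apply: sumr_ge0 => k _; apply: sumr_ge0 => j _; rewrite mulr_ge0. Qed.

Lemma t_exponent_le_chow_weight F x : x \in msupp F ->
  t_exponent c x <= chow_weight c F.
Proof.
move=> xF; apply: ub_le_sup; last first.
  apply/eqP => /(congr1 (fun p => p@_x)); rewrite /t_coef mcoeff0 raddf_sum /=.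
  rewrite -big_filter (bigD1_seq x) /=; first last.
  - by rewrite filter_uniq ?msupp_uniq.
  - by rewrite mem_filter eqxx.
  rewrite mcoeffZ mcoeffX eqxx mulr1 big1 => [|y /negPf yx]; last first.
    by rewrite mcoeffZ mcoeffX yx mulr0.
  by move/eqP; rewrite addr0 mcoeff_eq0 xF.
(* All exponents being nonnegative, their sum bounds each of them. *)
exists (\sum_(y <- msupp F) t_exponent c y) => e /eqP Fe.
have [y yF <-] : exists2 y, y \in msupp F & t_exponent c y = e.
  apply: contrapT => no; apply: Fe; rewrite /t_coef big_seq_cond big_pred0 // => y.
  by apply/negP => /andP[yF /eqP ye]; apply: no; exists y.
rewrite (big_rem y yF) /= lerDl; apply: sumr_ge0 => z _; exact: t_exponent_ge0.
Qed.

(** The Chow form does not vanish at forms without common zero on [Y], so one of its monomials only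
    involves variables at nonzero coefficients; its k-th block has degree [Delta] and each variable
    there weighs at least [b k]. *)
Lemma chow_weight_lower_bound (L : closedFieldType) (iota : {rmorphism K -> L})
    (Y : set 'rV[L]_N.+1) Delta F (u : 'I_n.+1 -> 'I_N.+1 -> K) (b : 'I_n.+1 -> RR) :
    chow_form iota Y Delta F ->
    (forall y, Y y -> ~ forall k, proj_eval iota (linear_form (u k)) y = 0) ->
    (forall k j, u k j != 0 -> b k <= c j) ->
  Delta%:R * \sum_k b k <= chow_weight c F.
Proof.
case=> _ homF zeroF noY ub.
pose U := \matrix_(k, j) iota (u k j) : 'M[L]_(n.+1, N.+1).
have FU : (map_mpoly iota F).@[mxvec U 0] <> 0.
  move=> /zeroF[y Yy hy]; apply: (noY y Yy) => k; rewrite linear_form_eval.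
  by rewrite -[RHS](hy k); apply: eq_bigr => j _; rewrite mxE.
have [x xF xU] : exists2 x, x \in msupp F &
    forall k j, u k j = 0 -> x (mxvec_index k j) = 0%N.
  apply: contrapT => no; apply: FU.
  rewrite /map_mpoly (rmorph_mmap (meval (mxvec U 0)) (@mpolyC _ L \o iota)) /mmap.
  rewrite big_seq big1 // => x xF.
  have [k [j [ukj xkj]]] : exists k j, u k j = 0 /\ x (mxvec_index k j) <> 0%N.
    apply: contrapT => no'; apply: no; exists x => // k j ukj.
    by apply: contrapT => xkj; apply: no'; exists k, j.
  rewrite /mmap1 (bigD1 (mxvec_index k j)) //= mevalXU mxvecE mxE ukj rmorph0.
  by move/eqP/negPf: xkj; rewrite expr0n => ->; rewrite mul0r mulr0.
apply: le_trans (t_exponent_le_chow_weight xF).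
rewrite /t_exponent mulr_sumr; apply: ler_sum => k _.
rewrite -(homF k x xF) natr_sum mulr_suml; apply: ler_sum => j _.
have [u0|u0] := eqVneq (u k j) 0; first by rewrite xU // !mul0r.
by rewrite ler_wpM2l ?ler0n // ub.
Qed.

End ChowWeight.

Section Dimension.
Variables (K : fieldType) (L : closedFieldType) (iota : {rmorphism K -> L}).
Variables (N : nat) (RR : realType).
Implicit Types (Z Y : set 'rV[L]_N.+1).
Local Notation chain := (irreducible_chain iota).

Lemma chain_le_proj_dim Z l : chain Z l -> (l%:R%:E <= proj_dim iota RR Z)%E.
Proof. by move=> cZ; apply: ereal_sup_ubound; exists l. Qed.

Lemma proj_dim_le Z (d : nat) : ~ chain Z d.+1 -> (proj_dim iota RR Z <= d%:R%:E)%E.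
Proof.
move=> nc; apply: ge_ereal_sup => _ [l /= cl <-]; rewrite lee_fin ler_nat leqNgt.
by apply/negP => dl; apply: nc; apply: irreducible_chain_leq cl.
Qed.

Lemma proj_dim_chain Z n : proj_dim iota RR Z = n.+1%:R%:E ->
  chain Z n.+1 /\ ~ chain Z n.+2.
Proof.
move=> dZ; split.
  apply: contrapT => /proj_dim_le; rewrite dZ lee_fin ler_nat ltnn //.
by move=> /chain_le_proj_dim; rewrite dZ lee_fin ler_nat ltnn.
Qed.

(** The chain bounds the codimension of the section by [r]. Since [Y] lies in no [D j], this
    codimension is also positive, so the quotient in the distributive constant can be cleared. *)
Lemma distributive_constantP Y n q (D : 'I_q -> set 'rV[L]_N.+1) delta :
    projective_subvariety iota Y -> proj_dim iota RR Y = n.+1%:R%:E ->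
    (forall j, ~ (Y `<=` D j)) ->
    (distributive_constant iota RR Y D <= delta%:E)%E ->
  forall (J : {set 'I_q}) r, (0 < #|J|)%N -> (r <= n.+1)%N ->
  chain (Y `&` [set y | forall j, j \in J -> D j y]) (n.+1 - r) ->
  #|J|%:R <= delta * r%:R.
Proof.
move=> irrY dY nD dist J r J0 rn cJ; set W := _ `&` _ in cJ.
have [_ nY] := proj_dim_chain dY.
have nW : ~ chain W n.+1.
  move=> cW; apply: nY; apply: irreducible_chain_extend cW => //.
  split=> [y []//|sub]; have /card_gt0P[j jJ] := J0.
  by apply: (nD j) => y /sub [_]; apply.
have := chain_le_proj_dim cJ; have := proj_dim_le nW.
have := le_trans (le_bigmax_cond -oo%E
   (fun J : {set 'I_q} => (#|J|%:R%:E / (proj_dim iota RR Y -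
       proj_dim iota RR (Y `&` [set y | forall j, j \in J -> D j y])))%E) J0) dist.
rewrite -/W dY; case: (proj_dim iota RR W) => [d| |] //.
rewrite !lee_fin -EFinB inver natrB // => + dn dr.
have dn0 : 0 < n.+1%:R - d by rewrite subr_gt0 (le_lt_trans dn) // ltr_nat.
rewrite gt_eqF // -EFinM lee_fin ler_pdivrMr // => h.
have delta0 : 0 < delta.
  by rewrite -(pmulr_lgt0 _ dn0); apply: lt_le_trans h; rewrite ltr0n.
by apply: le_trans h _; rewrite ler_pM2l //; lra.
Qed.

End Dimension.

(** * Dimension of hyperplane sections *)

Section Sections.
Variables (K : fieldType) (L : closedFieldType) (iota : {rmorphism K -> L}).
Variable N : nat.
Implicit Types (Z : set 'rV[L]_N.+1).
Local Notation chain := (irreducible_chain iota).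
Hypothesis char0 : [pchar L] =i pred0.

Lemma chain_meets_coordinates Z d (s : seq 'I_N.+1) : chain Z d ->
  (size s <= d)%N -> exists2 y, Z y & forall j, j \in s -> y 0 j = 0.
Proof.
move=> cZ sd.
(* The list is padded with the zero form, which counts as homogeneous of degree 1. *)
pose M (k : 'I_d) : {mpoly K[N.+1]} := nth 0 [seq 'X_j | j <- s] k.
have [k|y Zy hy] := chain_meets_forms char0 cZ (M := M).
  rewrite /M; have [ks|sk] := ltnP k (size s).
    have [j0 _] : exists j0, j0 \in s by case: (s) ks => // j0 *; exists j0; rewrite mem_head.
    by rewrite (nth_map j0) // dhomogX /= mdeg1.
  by rewrite nth_default ?size_map // rpred0.
exists y => // j js; have js' : (index j s < d)%N by apply: leq_trans sd; rewrite index_mem.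
have := hy (Ordinal js'); rewrite /M /= (nth_map j) ?index_mem //.
by rewrite nth_index // proj_evalU.
Qed.

(** If the section had dimension below [l], then [l] linear forms without common zero on it would,
    together with [p], be [l.+1] forms without common zero on [Z]. *)
Lemma chain_hyperplane_section Z l (p : {mpoly K[N.+1]}) : zariski_closed iota Z ->
  p \is 1.-homog -> chain Z l.+1 ->
  chain (Z `&` [set y | y != 0 /\ proj_eval iota p y = 0]) l.
Proof.
move=> cZ p1 cc; apply: contrapT => nc; set W := _ `&` _ in nc.
have cW : zariski_closed iota W by apply: zariski_closedI (zariski_closed_zero _ p1).
have [k [C hC _]|u _ hu] := cut_by_forms char0 cW nc (B := fun=> [set: 'I_N.+1]%SET).
  have [[_ [y Cy] _] sub] := hC ord0; have [_ [y0 hy]] := sub y Cy.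
  by move/eqP: y0; apply; apply/rowP => j; rewrite mxE hy // finset.in_setT.
pose M k := oapp (fun k' => linear_form (u k')) p (unlift ord0 k).
have [k|y Zy hy] := chain_meets_forms char0 cc (M := M).
  by rewrite /M; case: unliftP => [k'|] _ //=; apply: linear_form_homog.
apply: (hu y).
  split=> //; split; first exact: zariski_closed_neq0 cZ Zy.
  by have := hy ord0; rewrite /M unlift_none.
by move=> k; have := hy (lift ord0 k); rewrite /M liftK.
Qed.

End Sections.

(** * The lower bound for the Chow weight *)

Theorem theorem2p2
    (RR : realType) (K : fieldExtType rat)
    (L : closedFieldType) (iota : {rmorphism K -> L})
    (algL : forall z : L, algebraicOver iota z)
    (N n m Delta : nat) (Y : set 'rV[L]_N.+1)
    (n_ge1 : (1 <= n)%N) (n_le_m : (n <= m)%N)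
    (Yvar : projective_subvariety iota Y)
    (Ydim : proj_dim iota RR Y = n%:R%:E)
    (Ydeg : has_degree iota Y n Delta)
    (F : {mpoly K[n.+1 * N.+1]}) (FY : chow_form iota Y Delta F)
    (c : 'I_N.+1 -> RR) (c_ge0 : forall j, 0 <= c j)
    (i : 'I_m.+1 -> 'I_N.+1) (i_inj : injective i)
    (Yempty :
      Y `&` [set y : 'rV[L]_N.+1 | forall j, coord_hyperplane (i j) y] = set0)
    (Yproper : forall j, ~ (Y `<=` coord_hyperplane (i j)))
    (delta : RR)
    (Ydist : (distributive_constant iota RR Y
                (fun j => coord_hyperplane (i j)) <= delta%:E)%E) :
  Delta%:R * (n%:R + delta) / (m.+1%:R * delta) * \sum_(j < m.+1) c (i j)
    <= chow_weight c F.
Proof.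
have char0 : [pchar L] =i pred0.
  move=> p; rewrite (fmorph_pchar iota) (pchar_lalg K); exact: pchar_num.
case: n => [//|n] in n_ge1 n_le_m Ydim Ydeg F FY *.
have [cY _ _] := Yvar; have [chY nchY] := proj_dim_chain Ydim.
pose HJ (J : {set 'I_m.+1}) : set 'rV[L]_N.+1 :=
  Y `&` [set y | forall j, j \in J -> coord_hyperplane (i j) y].
have chain_delta := distributive_constantP Yvar Ydim Yproper Ydist.
(* Otherwise the at most [d] remaining hyperplanes would meet the section, against [Yempty]. *)
have chain_card J d : irreducible_chain iota (HJ J) d -> (d + #|J| <= m)%N.
  move=> cJ; rewrite leqNgt; apply/negP => mJ.
  have [|y [Yy HJy] hy] := chain_meets_coordinates char0 cJ (s := [seq i j | j <- enum (~: J)]).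
    by rewrite size_map -cardE cardsCs finset.setCK card_ord leq_subLR addnC.
  have : (Y `&` [set y | forall j, coord_hyperplane (i j) y]) y.
    split=> // j; have [/HJy //|jJ] := boolP (j \in J).
    split; first exact: zariski_closed_neq0 cY Yy.
    by apply: hy; apply: map_f; rewrite mem_enum finset.in_setC.
  by rewrite Yempty.
(* A single hyperplane has codimension at most 1 on [Y]. *)
have delta_ge1 : 1 <= delta.
  rewrite -[delta]mulr1; have := chain_delta [set ord0]%SET 1%N.
  rewrite cards1; apply=> //; rewrite subn1 /=.
  have X1 : ('X_(i ord0) : {mpoly K[N.+1]}) \is 1.-homog by rewrite dhomogX /= mdeg1.
  apply: irreducible_chainS (chain_hyperplane_section char0 cY X1 chY).
  move=> y [Yy [y0 hy]]; split=> // j; rewrite finset.in_set1 => /eqP ->.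
  by split=> //; rewrite -hy proj_evalU.
pose le_c (a b : 'I_m.+1) := c (i b) <= c (i a).
pose e := sort le_c (enum 'I_m.+1).
have e_size : size e = m.+1 by rewrite size_sort size_enum_ord.
have e_mem j : j \in e by rewrite mem_sort mem_enum.
have e_uniq : uniq e by rewrite sort_uniq enum_uniq.
have e_sorted : sorted le_c e by apply: sort_sorted => a b; apply: le_total.
pose cs k := c (i (nth ord0 e k)).
have cs_le k l : (k <= l)%N -> (l < m.+1)%N -> cs l <= cs k.
  move=> kl lm; apply: (sorted_leq_nth _ _ ord0 e_sorted) => //.
  - by move=> a b a' ba aa'; apply: le_trans aa' ba.
  - by move=> a; apply: lexx.
  - by rewrite inE e_size (leq_ltn_trans kl).
  - by rewrite inE e_size.
pose J k := [set j in take k e]%SET.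
have cardJ k : (k <= m.+1)%N -> #|J k| = k.
  move=> km; rewrite /J cardsE (card_uniqP _) ?take_uniq // size_take e_size.
  by case: ltngtP km => // ->.
(* [Y] now has dimension n + 1. The index [m] qualifies, since all the hyperplanes together miss
   [Y]. *)
have /choice[t ht] (s : 'I_n.+2) : exists t,
    ~ irreducible_chain iota (HJ (J t.+1)) (n.+1 - s) /\
    forall t', ~ irreducible_chain iota (HJ (J t'.+1)) (n.+1 - s) -> (t <= t')%N.
  have ex : exists t, `[< ~ irreducible_chain iota (HJ (J t.+1)) (n.+1 - s) >].
    by exists m; apply/asboolP => /chain_card; rewrite cardJ //; lia.
  case: (ex_minnP ex) => t /asboolP nt tmin; exists t; split=> // t' nt'.
  exact/tmin/asboolP.
have t_le_m s : (t s <= m)%N.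
  by have [_] := ht s; apply => /chain_card; rewrite cardJ //; lia.
(* By minimality, one hyperplane fewer still leaves dimension at least n + 1 - s. *)
have t_chain s : (0 < t s)%N -> irreducible_chain iota (HJ (J (t s))) (n.+1 - s).
  move=> ts; apply: contrapT => nc; have [_ /(_ (t s).-1)] := ht s.
  by rewrite prednK // => /(_ nc); lia.
have t_le s : (t s + n.+1 <= m + s)%N.
  have [->|/t_chain /chain_card] := posnP (t s); first by lia.
  by rewrite cardJ ?leqW //; lia.
have t_delta (s : 'I_n.+2) : (t s)%:R <= delta * s%:R.
  have [->|ts] := posnP (t s); first by rewrite mulr_ge0 //; lra.
  have := chain_delta (J (t s)) s; rewrite cardJ; last exact: leqW.
  by apply=> //; [rewrite -ltnS | apply: t_chain].
have [|s|u hu noY] := @cut_by_forms _ _ iota N char0 n.+2 Y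
  (fun s => [set i j | j in J (t s).+1]%SET) cY.
- exact: nchY.
- have [nc _] := ht s; apply: contra_not nc; rewrite subSS.
  apply: irreducible_chainS => y [Yy [y0 hy]]; split=> // j jJ.
  by split=> //; apply: hy; apply: imset_f.
have cs_u s j : u s j != 0 -> cs (t s) <= c j.
  have [|/hu -> /eqP //] := boolP (j \in [set i j | j in J (t s).+1]%SET).
  case/imsetP => j'; rewrite inE in_take // => lt ->.
  by move=> _; have := cs_le (index j' e) (t s) lt (t_le_m s); rewrite {2}/cs nth_index.
apply: le_trans (chow_weight_lower_bound c_ge0 FY noY cs_u).
have -> : \sum_(j < m.+1) c (i j) = \sum_(j < m.+1) cs j.
  transitivity (\sum_(j <- e) c (i j)); last by rewrite (big_nth ord0) e_size big_mkord.
  by rewrite -big_enum; apply: perm_big; rewrite perm_sym perm_sort.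
rewrite -mulrA -mulrA ler_wpM2l // mulrA.
by apply: weighted_selection => // j jm; [apply: c_ge0 | apply: cs_le].
Qed.
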